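(* Let $\{\omega^{s,t}\}_{s,t\in[0,1]}$ be doubling weights on $\mathbb{T}\otimes\mathbb{T}$ with doubling constants at most $C_{\rm dbl}$, and suppose $(s,t,x,y)\mapsto\omega^{s,t}(x,y)$ is measurable. (1) Fix $1\le p\le\infty$; if $\omega^{s,t}\in A_p^d(\mathbb{T}\otimes\mathbb{T})$ with $A_p^d(\omega^{s,t})\le V_{p,d}$ for all $s,t$, then $\omega(x,y)=\int_0^1\!\int_0^1\omega^{s,t}(x+s,y+t)\,ds\,dt$ belongs to $A_p(\mathbb{T}\otimes\mathbb{T})$ with constant depending only on $p,V_{p,d},C_{\rm dbl}$. (2) Fix $1<p\le\infty$; if $\omega^{s,t}\in RH_p^d(\mathbb{T}\otimes\mathbb{T})$ with $RH_p^d(\omega^{s,t})\le V_{p,d}$ for all $s,t$, then $\omega\in RH_p(\mathbb{T}\otimes\mathbb{T})$ with $RH_p(\omega)$ depending only on $p,V_{p,d},C_{\rm dbl}$.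
   Context: $\mathbb{T}$ is the circle $[0,1]$ with endpoints identified, additions mod 1; $\mathbb{T}\otimes\mathbb{T}=\mathbb{T}^2$. Rectangles $R=Q_1\times Q_2$ ($Q_i$ intervals), dyadic rectangles $I\times J$ ($I,J\in\mathcal{D}=\{[0,1]\}\cup\{[j2^{-k},(j+1)2^{-k})\}$). $\omega$ is doubling with constant $C$ if $\int_{\widetilde Q_1\times\widetilde Q_2}\omega\le C\int_{Q_1\times Q_2}\omega$ for all rectangles, $\widetilde Q$ being the interval with the same midpoint and twice the length. $-\!\!\!\!\!\!\int_E f=\frac1{|E|}\int_Ef$. Product $A_p$, $RH_p$ constants are the one-variable definitions with intervals replaced by rectangles: $A_p(\omega)=\sup_R(-\!\!\!\!\!\!\int_R\omega)(-\!\!\!\!\!\!\int_R\omega^{-1/(p-1)})^{p-1}$ ($1<p<\infty$), $A_1(\omega)=\sup_R(-\!\!\!\!\!\!\int_R\omega)/\operatorname{ess\,inf}_R\omega$, $A_\infty(\omega)=\sup_R(-\!\!\!\!\!\!\int_R\omega)\exp(-\!\!\!\!\!\!\int_R\log(1/\omega))$, $RH_p(\omega)=\sup_R(-\!\!\!\!\!\!\int_R\omega^p)^{1/p}(-\!\!\!\!\!\!\int_R\omega)^{-1}$, $RH_\infty(\omega)=\sup_R(\operatorname{ess\,sup}_R\omega)(-\!\!\!\!\!\!\int_R\omega)^{-1}$. Dyadic versions take suprema over dyadic rectangles; $RH_p^d$ additionally requires dyadic doubling ($\int_{\widetilde I\times\widetilde J}\omega\le C\int_{I\times J}\omega$, $\widetilde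 I$ the dyadic interval of length $2|I|$ containing $I$), with $RH_p^d(\omega)$ the max of the dyadic supremum and this doubling constant.
   Formalization: The averaged function ω is additionally assumed integrable on 𝕋⊗𝕋 (i.e. a weight); without this the claim fails, e.g. ω^{s,t}≡1/s gives ω≡+∞. *)

(* Defs.v *)
From HB Require Import structures.
From mathcomp Require Import all_boot all_order all_algebra.
From mathcomp Require Import all_classical all_reals all_analysis.
Set Implicit Arguments. Unset Strict Implicit. Unset Printing Implicit Defensive.
Import Order.TTheory GRing.Theory Num.Theory.
Import numFieldNormedType.Exports.
Local Open Scope classical_set_scope.
Local Open Scope ring_scope.

Section WeightDefs.
Variable R : realType.

(* The circle T is modelled by [0,1); addition mod 1 is via [tfrac]. *)
Definition tfrac (x : R) : R := x - (Num.floor x)%:~R.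

(* Two-dimensional Lebesgue measure on R x R (we only integrate over
   subsets of [0,1)^2 = T x T). *)
Definition mu2 := ((@lebesgue_measure R) \x (@lebesgue_measure R))%E.

Definition unitI : set R := `[0, 1]%classic.

Definition torus : set (R * R) := `[0, 1[%classic `*` `[0, 1[%classic.

(* An interval (tarc) of T with left endpoint a (mod 1) and length l,
   0 < l <= 1.  If l >= 1 it is the whole circle. *)
Definition tarc (a l : R) : set R :=
  [set x | exists u, 0 <= u < l /\ x = tfrac (a + u)].

Definition rect (a1 l1 a2 l2 : R) : set (R * R) := tarc a1 l1 `*` tarc a2 l2.

Definition rect_param (l1 l2 : R) : Prop := 0 < l1 <= 1 /\ 0 < l2 <= 1.

Definition rects : set (set (R * R)) :=
  [set Q | exists a1 l1 a2 l2, rect_param l1 l2 /\ Q = rect a1 l1 a2 l2].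

Definition dyad (k j : nat) : set R :=
  [set x | j%:R / 2 ^+ k <= x < j.+1%:R / 2 ^+ k].

Definition dyad_ok (k j : nat) : Prop := (j < 2 ^ k)%N.

Definition dyad_rect (k1 j1 k2 j2 : nat) : set (R * R) :=
  dyad k1 j1 `*` dyad k2 j2.

Definition dyad_rects : set (set (R * R)) :=
  [set Q | exists k1 j1 k2 j2, dyad_ok k1 j1 /\ dyad_ok k2 j2 /\
           Q = dyad_rect k1 j1 k2 j2].

(* The dyadic parent: the dyadic interval of twice the length containing
   the given one; the whole circle T is its own parent. *)
Definition dyad_parent (k j : nat) : nat * nat :=
  if k is k'.+1 then (k', j./2) else (0%N, 0%N).

Local Open Scope ereal_scope.

Definition avg (E : set (R * R)) (f : R * R -> \bar R) : \bar R :=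
  (\int[mu2]_(z in E) f z) * ((fine (mu2 E))^-1)%:E.

Definition esssup_on (E : set (R * R)) (f : R * R -> \bar R) : \bar R :=
  ereal_inf [set M | \forall z \ae mu2, E z -> f z <= M].
Definition essinf_on (E : set (R * R)) (f : R * R -> \bar R) : \bar R :=
  ereal_sup [set M | \forall z \ae mu2, E z -> M <= f z].

(* A weight on T x T is given as w : R -> R -> \bar R (only its values
   on [0,1)^2 matter); [wf w] is w viewed as a function of the pair. *)
Definition wf (w : R -> R -> \bar R) : R * R -> \bar R := fun z => w z.1 z.2.

Definition Ap_rect (p : \bar R) (w : R -> R -> \bar R) (Q : set (R * R))
  : \bar R :=
  match p with
  | r%:E =>
    if r == 1%R then avg Q (wf w) * (essinf_on Q (wf w))^-1
    else avg Q (wf w) *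
         poweR (avg Q (fun z => poweR (wf w z)^-1 (r - 1)^-1)) (r - 1)
  | +oo => avg Q (wf w) * expeR (avg Q (fun z => lne (wf w z)^-1))
  | -oo => 0
  end.

Definition RHp_rect (p : \bar R) (w : R -> R -> \bar R) (Q : set (R * R))
  : \bar R :=
  match p with
  | r%:E => poweR (avg Q (fun z => poweR (wf w z) r)) r^-1 *
            (avg Q (wf w))^-1
  | +oo => esssup_on Q (wf w) * (avg Q (wf w))^-1
  | -oo => 0
  end.

Definition Ap (p : \bar R) (w : R -> R -> \bar R) : \bar R :=
  ereal_sup [set Ap_rect p w Q | Q in rects].
Definition Apd (p : \bar R) (w : R -> R -> \bar R) : \bar R :=
  ereal_sup [set Ap_rect p w Q | Q in dyad_rects].
Definition RHp (p : \bar R) (w : R -> R -> \bar R) : \bar R :=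
  ereal_sup [set RHp_rect p w Q | Q in rects].

Definition dyad_dbl_const (w : R -> R -> \bar R) : \bar R :=
  ereal_inf [set C | forall k1 j1 k2 j2, dyad_ok k1 j1 -> dyad_ok k2 j2 ->
     \int[mu2]_(z in dyad_rect (dyad_parent k1 j1).1 (dyad_parent k1 j1).2
                               (dyad_parent k2 j2).1 (dyad_parent k2 j2).2)
        wf w z
     <= C * \int[mu2]_(z in dyad_rect k1 j1 k2 j2) wf w z].

Definition RHpd (p : \bar R) (w : R -> R -> \bar R) : \bar R :=
  maxe (ereal_sup [set RHp_rect p w Q | Q in dyad_rects]) (dyad_dbl_const w).

(* The interval with the same midpoint and twice the length. *)
Definition doubling (C : R) (w : R -> R -> \bar R) : Prop :=
  forall a1 l1 a2 l2, rect_param l1 l2 ->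
    \int[mu2]_(z in rect (a1 - l1 / 2) (2 * l1) (a2 - l2 / 2) (2 * l2)) wf w z
    <= C%:E * \int[mu2]_(z in rect a1 l1 a2 l2) wf w z.

Definition weight (w : R -> R -> \bar R) : Prop :=
  (forall x y, torus (x, y) -> 0 <= w x y) /\ mu2.-integrable torus (wf w).

Definition family_hyp (C : R) (w : R -> R -> R -> R -> R) : Prop :=
  (forall s t, s \in `[0, 1]%R -> t \in `[0, 1]%R ->
     weight (fun x y => (w s t x y)%:E) /\
     doubling C (fun x y => (w s t x y)%:E)) /\
  measurable_fun ((unitI `*` unitI) `*` torus)
    (fun q : (R * R) * (R * R) => w q.1.1 q.1.2 q.2.1 q.2.2).

Definition avg_weight (w : R -> R -> R -> R -> R) : R -> R -> \bar R :=
  fun x y => \int[mu2]_(st in unitI `*` unitI)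
               (w st.1 st.2 (tfrac (x + st.1)) (tfrac (y + st.2)))%:E.

End WeightDefs.

(* Main.v *)
Require Import Defs.
From HB Require Import structures.
From mathcomp Require Import all_boot all_order all_algebra.
From mathcomp Require Import all_classical all_reals all_analysis.
From mathcomp Require Import measurable_realfun.
From mathcomp Require Import ring lra.
Set Implicit Arguments.
Unset Strict Implicit.
Unset Printing Implicit Defensive.
Import Order.TTheory GRing.Theory Num.Theory.
Local Open Scope classical_set_scope.
Local Open Scope ring_scope.

(* Doubling lets one pass from dyadic to arbitrary rectangles for each
   [w s t] separately: a rectangle is covered by four dyadic rectangles of
   comparable size and comparable mass. On a fixed rectangle, each of the
   resulting A_p and RH_p bounds is equivalent, up to constants, to a family of
   inequalities that are linear in the weight, namely comparisons between
   [avg w] and [avg (g * w)] for bounded test functions [g]: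

     A_p    (avg f / 2) ^ p * avg w <= K * avg (f ^ p * w)
     A_oo   exp (avg h) * avg w <= K * avg (exp h * w)
     RH_p   avg (m ^ (p - 1) * w) <= K * (avg (m ^ p)) ^ ((p - 1) / p) * avg w

   Linear inequalities are preserved by rotations of the torus and, by
   Tonelli, by averaging over (s, t). The bounds for the average [W] follow by
   choosing the test function to be a truncation of [W ^ (-1 / (p - 1))],
   [log^+ (avg W / W)] and [W] respectively, and an indicator function for A_1
   and RH_oo. *)

(** * Arcs and rotations of the circle *)

(** The [A_p] and [RH_p] quantities multiply averages of different powers, so they cannot be
    integrated in [(s, t)]. In a linear inequality all the nonlinearity sits in the test function,
    which is built from [W] and does not depend on [(s, t)]. When a rectangle is rotated, the test
    function is rotated with it, so its average is the same number [F] for every [(s, t)] and may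
    stand outside the integral. The argument then closes by cancelling a power of [F] (or, for an
    indicator, by forcing [F = 0]). That requires [F] to be finite, whereas [W] may be [0] or [+oo]
    at some points: hence the truncations at level [n], removed by monotone convergence because the
    bounds do not depend on [n]. The inequalities of Young type are deliberately crude; their loss
    is the source of the factors 2. The powers [C ^ 2] and [C ^ 3] count the doublings after which a
    dyadic rectangle swallows the given one, and conversely. *)

Section Circle.
Variable R : realType.
Implicit Types a b l s t x y : R.

Lemma tfrac_ge0 x : 0 <= tfrac x.
Proof. by rewrite /tfrac subr_ge0 floor_le. Qed.

Lemma tfrac_lt1 x : tfrac x < 1.
Proof. by rewrite /tfrac ltrBlDr addrC -[X in _ + X]/(1%:~R) -intrD floorD1_gt. Qed.

Lemma tfrac_itv x : 0 <= tfrac x < 1.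
Proof. by rewrite tfrac_ge0 tfrac_lt1. Qed.

Lemma tfrac_id x : 0 <= x < 1 -> tfrac x = x.
Proof.
move=> x01; rewrite /tfrac (_ : Num.floor x = 0) ?subr0//.
by apply/eqP; rewrite floor_eq add0r.
Qed.

Lemma tfracDz x (n : int) : tfrac (x + n%:~R) = tfrac x.
Proof. by rewrite /tfrac floorDrz ?intr_int// intrD intrKfloor; lra. Qed.

Lemma tfracD_tfrac x y : tfrac (tfrac x + y) = tfrac (x + y).
Proof.
by rewrite {2}/tfrac -addrA [- _ + y]addrC addrA -mulrNz tfracDz.
Qed.

Lemma tfrac_le x : 0 <= x -> tfrac x <= x.
Proof. by move=> x0; rewrite /tfrac gerBl ler0z floor_ge0. Qed.

Lemma measurable_tfrac : measurable_fun setT (@tfrac R).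
Proof.
apply: measurable_funB => //.
apply: nondecreasing_measurable => // x y xy.
by rewrite ler_int le_floor.
Qed.

(** [tfrac (x - a)] is the offset of [x] from the left endpoint, the smallest nonnegative [u] that
    parametrises [x]. This form involves only [x - a], which gives both measurability and rotation
    invariance. *)
Lemma tarcE a l : tarc a l = `[0, 1[ `&` [set x | tfrac (x - a) < l].
Proof.
apply/seteqP; split => x /=.
  move=> [u [/andP[u0 ul] ->]]; rewrite in_itv/= tfrac_itv; split => //.
  by rewrite tfracD_tfrac addrAC subrr add0r (le_lt_trans (tfrac_le u0)).
rewrite in_itv/= => -[x01 xl]; exists (tfrac (x - a)); rewrite tfrac_ge0 xl; split => //.
by rewrite addrC tfracD_tfrac subrK tfrac_id.
Qed.

Lemma tarc_sub a l b l' : b <= a -> a + l <= b + l' -> tarc a l `<=` tarc b l'.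
Proof.
move=> ba al x [u [/andP[u0 ul] ->]]; exists (u + (a - b)); split; first by lra.
by congr tfrac; lra.
Qed.

Lemma tarc_tfrac a l : tarc (tfrac a) l = tarc a l.
Proof.
by apply/seteqP; split => x [u [ul ->]]; exists u; rewrite tfracD_tfrac.
Qed.

Lemma tarc_full a l : 1 <= l -> tarc a l = `[0, 1[%classic.
Proof.
move=> l1; rewrite tarcE; apply/seteqP; split => x /=; first by case.
by move=> ?; split => //; exact: lt_le_trans (tfrac_lt1 _) l1.
Qed.

Lemma tarc_sub01 a l : tarc a l `<=` `[0, 1[%classic.
Proof. by rewrite tarcE => x []. Qed.

Lemma measurable_tarc a l : measurable (tarc a l).
Proof.
rewrite tarcE; apply: measurableI => //; rewrite -[X in measurable X]setTI.
have mf : measurable_fun setT (fun x : R => tfrac (x - a)).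
  by apply: measurableT_comp; [exact: measurable_tfrac|exact: measurable_funB].
have -> : [set x | tfrac (x - a) < l] = (fun x : R => tfrac (x - a)) @^-1` `]-oo, l[.
  by apply/seteqP; split=> x /=; rewrite in_itv.
exact: mf.
Qed.

Lemma lebesgue_shift a (A : set R) : measurable A ->
  lebesgue_measure ((fun x : R => x + a) @^-1` A) = lebesgue_measure A.
Proof.
move=> mA.
have mf : measurable_fun setT ((fun x => x + a) : measurableTypeR R -> measurableTypeR R).
  exact: measurable_funD.
pose f : {mfun measurableTypeR R >-> measurableTypeR R} :=
  HB.pack (fun x : measurableTypeR R => (x + a : measurableTypeR R))
          (isMeasurableFun.Build _ _ _ _ _ mf).
rewrite -[LHS]/(pushforward lebesgue_measure f A).
apply/esym/lebesgue_measure_unique => //= _ [[c d]] _ <-.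
rewrite /= /pushforward (_ : _ @^-1` _ = `]c - a, d - a]%classic); last first.
  by apply/seteqP; split => x /=; rewrite !in_itv/= ltrBlDr lerBrDr.
rewrite !lebesgue_measure_itv/= !lte_fin ltrD2r; case: ifP => // _.
by rewrite -!EFinB; congr EFin; lra.
Qed.

Lemma integral_shift a (D : set R) (h : R -> \bar R) : measurable D ->
  measurable_fun setT h -> (forall x, (0 <= h x)%E) ->
  (\int[lebesgue_measure]_(x in (fun x : R => (x + a)%R) @^-1` D) h (x + a)%R =
   \int[lebesgue_measure]_(x in D) h x)%E.
Proof.
move=> mD mh h0.
have mf : measurable_fun setT ((fun x => x + a) : measurableTypeR R -> measurableTypeR R).
  exact: measurable_funD.
have := @ge0_integral_pushforward _ _ _ _ R _ mf lebesgue_measure D h mD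
  (measurable_funTS mh) (fun y _ => h0 y).
rewrite /comp => <-; apply: eq_measure_integral => A mA _.
exact: (lebesgue_shift a).
Qed.

Lemma measurable_shift_preimage a (D : set R) : measurable D ->
  measurable ((fun x : R => x + a) @^-1` D).
Proof.
move=> mD; rewrite -[X in measurable X]setTI.
by apply: (_ : measurable_fun setT (fun x : R => x + a)) => //; exact: measurable_funD.
Qed.

Lemma measurable_rotation s : measurable_fun setT (fun x : R => tfrac (x + s)).
Proof.
by apply: measurableT_comp; [exact: measurable_tfrac|exact: measurable_funD].
Qed.

(** Once [s] is reduced to [[0, 1)], the rotation consists of two translations: by [s] on the points
    that stay below 1, by [s - 1] on those that pass 1. Their images [[s, 1)] and [[0, s)] partition
    the circle. *)
Lemma integral_rotation s (h : R -> \bar R) : measurable_fun setT h ->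
  (forall x, (0 <= h x)%E) ->
  (\int[lebesgue_measure]_(x in `[0%R, 1%R[) h (tfrac (x + s)%R) =
   \int[lebesgue_measure]_(x in `[0%R, 1%R[) h x)%E.
Proof.
move=> mh h0.
wlog s01 : s / 0 <= s < 1.
  move=> /(_ (tfrac s) (tfrac_itv s)) <-; apply: eq_integral => x _.
  by rewrite [x + tfrac s]addrC tfracD_tfrac [s + x]addrC.
have E1 : `[0%R, 1%R[%classic = ((fun x : R => x + s) @^-1` `[s, 1[) `|`
    ((fun x : R => x + (s - 1)) @^-1` `[0, s[).
  apply/seteqP; split => x /=; rewrite !in_itv/=; last by move=> []; lra.
  by move=> x01; have [|] := ltP (x + s) 1; [left|right]; lra.
have E2 : `[0%R, 1%R[%classic = `[s, 1[ `|` `[0, s[.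
  apply/seteqP; split => x /=; rewrite !in_itv/=; last by move=> []; lra.
  by move=> x01; have [|] := ltP x s; [right|left]; lra.
rewrite {1}E1 ge0_integral_setU; last 5 first.
- exact: measurable_shift_preimage.
- exact: measurable_shift_preimage.
- apply: measurable_funTS; exact: (measurableT_comp mh (measurable_rotation s)).
- by [].
- by rewrite disj_set2E; apply/eqP/seteqP; split => x //=; rewrite !in_itv/= => -[]; lra.
rewrite [in RHS]E2 ge0_integral_setU; last 5 first.
- exact: measurable_itv.
- exact: measurable_itv.
- exact: measurable_funTS.
- by [].
- by rewrite disj_set2E; apply/eqP/seteqP; split => x //=; rewrite !in_itv/= => -[]; lra.
rewrite -[X in _ = (X + _)%E](integral_shift s)// -[X in _ = (_ + X)%E](integral_shift (s - 1))//.
congr (_ + _)%E; apply: eq_integral => x /[!inE]/=; rewrite in_itv/= => xs.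
  by rewrite tfrac_id//; lra.
by rewrite -(@tfracDz (x + s) (-1)) mulrNz mulr1z -addrA tfrac_id//; lra.
Qed.

(** Rotating the arc back to [[0, l)] removes the wrap-around. *)
Lemma measure_tarc a l : 0 < l <= 1 -> lebesgue_measure (tarc a l) = l%:E.
Proof.
move=> /andP[l0 l1]; rewrite -(setIT (tarc a l)) -integral_indic//; last exact: measurable_tarc.
rewrite integral_mkcond/=.
transitivity (\int[lebesgue_measure]_(x in `[0%R, 1%R[) (\1_(`[0, l[) (tfrac (x + - a)%R))%:E)%E.
  rewrite [RHS]integral_mkcond; apply: eq_integral => x _; rewrite !patchE.
  rewrite in_setT !indicE.
  have -> : (x \in tarc a l) = (x \in `[0, 1[%classic) && (tfrac (x - a) < l).
    by rewrite tarcE in_setI; congr (_ && _); apply/idP/idP; rewrite inE.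
  have -> : (tfrac (x - a) \in `[0, l[%classic) = (tfrac (x - a) < l).
    by rewrite mem_setE in_itv/= tfrac_ge0.
  by case: (x \in _) => //=; case: ifP.
rewrite (@integral_rotation (- a) (fun x => (\1_(`[0, l[) x)%:E)).
- rewrite integral_indic//= (_ : _ `&` _ = `[0, l[%classic).
    by rewrite lebesgue_measure_itv/= lte_fin l0 oppr0 adde0.
  apply/seteqP; split => x /=; rewrite !in_itv/=; first by case.
  by move=> ?; split; lra.
- by apply/measurable_EFinP; exact: measurable_indic.
- by move=> x; rewrite lee_fin.
Qed.

End Circle.

(** * Rectangles in the torus and dyadic covers *)

Section Torus.
Variable R : realType.
Implicit Types a b d l s t x y C : R.
Local Notation mu := (@lebesgue_measure R).
Local Notation mu2 := (@mu2 R).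

Lemma measurable_rect a1 l1 a2 l2 : measurable (rect a1 l1 a2 l2 : set (R * R)).
Proof. by apply: measurableX; exact: measurable_tarc. Qed.

Lemma measurable_torus : measurable (@torus R).
Proof. by apply: measurableX. Qed.

Lemma rect_sub_torus a1 l1 a2 l2 : rect a1 l1 a2 l2 `<=` @torus R.
Proof. by move=> z [z1 z2]; split; [move: z1|move: z2]; exact: tarc_sub01. Qed.

Lemma measure_rect a1 l1 a2 l2 : rect_param l1 l2 ->
  mu2 (rect a1 l1 a2 l2) = (l1 * l2)%:E.
Proof.
move=> [l1p l2p]; rewrite /Defs.mu2 product_measure1E; [|exact: measurable_tarc..].
by rewrite EFinM; congr (_ * _)%E; exact: measure_tarc.
Qed.

Lemma rect_subset a1 l1 a2 l2 b1 d1 b2 d2 :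
  tarc a1 l1 `<=` tarc b1 d1 -> tarc a2 l2 `<=` tarc b2 d2 ->
  rect a1 l1 a2 l2 `<=` rect b1 d1 b2 d2.
Proof. by move=> h1 h2 z [z1 z2]; split; [exact: h1|exact: h2]. Qed.

Lemma integral_setX (A B : set R) (F : R * R -> \bar R) :
  measurable A -> measurable B -> measurable_fun setT F -> (forall z, 0 <= F z)%E ->
  (\int[mu2]_(z in A `*` B) F z = \int[mu]_(x in A) \int[mu]_(y in B) F (x, y))%E.
Proof.
move=> mA mB mF F0; rewrite integral_mkcond /Defs.mu2 fubini_tonelli1; last 2 first.
- by apply/(measurable_restrict _ _ _).1 => //; [exact: measurableX|exact: measurable_funTS].
- by move=> z; rewrite patchE; case: ifP.
rewrite [RHS]integral_mkcond; apply: eq_integral => x _.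
rewrite /fubini_F patchE; case: ifPn => xA.
  rewrite [RHS]integral_mkcond; apply: eq_integral => y _.
  by rewrite !patchE in_setX/= xA.
by apply: integral0_eq => y _; rewrite patchE in_setX/= (negbTE xA).
Qed.

Lemma measurable_rotation2 s t :
  measurable_fun setT (fun z : R * R => (tfrac (z.1 + s), tfrac (z.2 + t))).
Proof.
apply: measurable_fun_pair.
  exact: (measurableT_comp (measurable_rotation s) measurable_fst).
exact: (measurableT_comp (measurable_rotation t) measurable_snd).
Qed.

Lemma integral_torus_rotation s t (F : R * R -> \bar R) :
  measurable_fun setT F -> (forall z, 0 <= F z)%E ->
  (\int[mu2]_(z in @torus R) F (tfrac (z.1 + s)%R, tfrac (z.2 + t)%R) =
   \int[mu2]_(z in @torus R) F z)%E.
Proof.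
move=> mF F0; rewrite /torus integral_setX//; last first.
  exact: (measurableT_comp mF (measurable_rotation2 s t)).
rewrite [RHS]integral_setX//=.
pose h x := (\int[mu]_(y in `[0%R, 1%R[) F (x, y))%E.
have mh : measurable_fun setT h.
  pose F' := fun z : R * R => (F \_ (setT `*` `[0%R, 1%R[%classic)) z.
  rewrite (_ : h = fubini_F mu F').
    apply: measurable_fun_fubini_tonelli_F.
      apply/(measurable_restrict _ _ _).1 => //; first exact: measurableX.
      exact: measurable_funTS.
    by move=> z; rewrite /F' patchE; case: ifP.
  apply/funext => x; rewrite /h /fubini_F [LHS]integral_mkcond. apply: eq_integral => y _.
  by rewrite /F' !patchE in_setX/= in_setT.
transitivity (\int[mu]_(x in `[0%R, 1%R[) h (tfrac (x + s)%R))%E.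
  apply: eq_integral => x _; rewrite /h.
  apply: (@integral_rotation _ t (fun y => F (tfrac (x + s)%R, y))) => //.
  by apply: measurableT_comp => //; exact: measurable_fun_pair.
by apply: integral_rotation => // x; exact: integral_ge0.
Qed.

Lemma tarc_rotation a l s x : 0 <= x < 1 ->
  tarc (a + s) l (tfrac (x + s)) <-> tarc a l x.
Proof.
move=> x01; rewrite !tarcE/= !in_itv/= tfrac_itv x01 tfracD_tfrac.
by rewrite (_ : x + s - (a + s) = x - a)//; lra.
Qed.

(** Extending [F] by zero off the rotated rectangle reduces this to the rotation invariance of
    integrals over the whole torus. *)
Lemma integral_rect_rotation a1 l1 a2 l2 s t (F : R * R -> \bar R) :
  measurable_fun setT F -> (forall z, 0 <= F z)%E ->
  (\int[mu2]_(z in rect a1 l1 a2 l2) F (tfrac (z.1 + s)%R, tfrac (z.2 + t)%R) =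
   \int[mu2]_(z in rect (a1 + s) l1 (a2 + t) l2) F z)%E.
Proof.
move=> mF F0.
set Q' := rect (a1 + s) l1 (a2 + t) l2.
have mF' : measurable_fun setT (F \_ Q').
  apply/(measurable_restrict _ _ _).1 => //; first exact: measurable_rect.
  exact: measurable_funTS.
have F'0 z : (0 <= (F \_ Q') z)%E by rewrite patchE; case: ifP.
have := integral_torus_rotation s t mF' F'0.
rewrite [X in _ = X]integral_mkcond (_ : (F \_ Q') \_ (@torus R) = F \_ Q'); last first.
  apply/funext => z; rewrite !patchE; case: ifPn => // zT; case: ifPn => // zQ.
  by move: zT; rewrite notin_setE => -[]; move: zQ; rewrite inE; exact: rect_sub_torus.
rewrite -[X in _ = X]integral_mkcond => <-.
rewrite integral_mkcond [RHS]integral_mkcond; apply: eq_integral => z _.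
rewrite !patchE.
have [zT|zT] := boolP (z \in @torus R); last first.
  rewrite ifF//; apply: contraNF zT; rewrite !inE; exact: rect_sub_torus.
suff -> : (z \in rect a1 l1 a2 l2) = ((tfrac (z.1 + s), tfrac (z.2 + t)) \in Q') by [].
move: zT; rewrite inE => -[/=]; rewrite !in_itv/= => z1 z2.
apply/idP/idP; rewrite !inE => -[/= h1 h2].
  by split => /=; apply/tarc_rotation.
by split; [apply/(tarc_rotation a1 l1 s z1)|apply/(tarc_rotation a2 l2 t z2)].
Qed.

Lemma dyad_tarc k j : dyad_ok k j -> @dyad R k j = tarc (j%:R / 2 ^+ k) (2 ^+ k)^-1.
Proof.
rewrite /dyad_ok => jk; rewrite /dyad/tarc.
have k0 : 0 < (2 : R) ^+ k by rewrite exprn_gt0.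
have j1 : j.+1%:R / 2 ^+ k <= 1 :> R.
  by rewrite ler_pdivrMr// mul1r -natrX ler_nat.
have j0 : 0 <= j%:R / 2 ^+ k :> R by rewrite divr_ge0// ltW.
have jE : j.+1%:R / 2 ^+ k = j%:R / 2 ^+ k + (2 ^+ k)^-1 :> R.
  by rewrite -natr1 mulrDl mul1r.
apply/seteqP; split => x /=.
  move=> xj; exists (x - j%:R / 2 ^+ k); split; first by lra.
  by rewrite addrC subrK tfrac_id//; lra.
by move=> [u [ul ->]]; rewrite tfrac_id; lra.
Qed.

(** Take the least [k] with [2^-k < 2 l]. Minimality gives [2^-(k-1) >= 2 l], that is [2^-k >= l];
    for [k = 0] the latter is [l <= 1]. *)
Lemma exists_dyadic_scale l : 0 < l <= 1 ->
  exists k : nat, l <= (2 ^+ k)^-1 < 2 * l.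
Proof.
move=> /andP[l0 l1].
have [n nl] : exists n : nat, (2 ^+ n)^-1 < 2 * l.
  exists (Num.truncn (l^-1)); have := truncnS_gt l^-1.
  set n := Num.truncn _ => h.
  have h2 : n.+1%:R <= (2 : R) ^+ n by rewrite -natrX ler_nat ltn_expl.
  have : (2 ^+ n)^-1 < l.
    by rewrite -[ltRHS]invrK ltf_pV2 ?posrE ?exprn_gt0 ?invr_gt0//; lra.
  by lra.
case: (ex_minnP (ex_intro (fun n : nat => (2 ^+ n)^-1 < 2 * l) n nl)) => k kl kmin.
exists k; rewrite kl andbT.
case: k kl kmin => [|k] kl kmin; first by rewrite expr0 invr1.
rewrite leNgt; apply/negP => h.
suff /kmin : (2 ^+ k)^-1 < 2 * l by rewrite ltnn.
move: h; rewrite exprS invfM; set v := (2 ^+ k)^-1; lra.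
Qed.

(* The right-hand arcs are written as the outcome of two, respectively three,
   doublings of the left-hand arc of the other inclusion. *)
Definition close_arcs a l b d :=
  [/\ l <= d < 2 * l, tarc a l `<=` tarc (b - d / 2 - d) (2 * (2 * d)) &
      tarc b d `<=` tarc (a - l / 2 - l - 2 * l) (2 * (2 * (2 * l)))].

(** Since [l] is at most the dyadic length, the arc meets only the dyadic interval containing its
    left endpoint and the next one. *)
Lemma dyadic_arc_cover a l : 0 < l <= 1 ->
  exists k (j : bool -> nat) (b : bool -> R),
    [/\ forall i, dyad_ok k (j i), forall i, @dyad R k (j i) = tarc (b i) (2 ^+ k)^-1,
        forall i, close_arcs a l (b i) (2 ^+ k)^-1 &
        tarc a l `<=` tarc (b true) (2 ^+ k)^-1 `|` tarc (b false) (2 ^+ k)^-1].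
Proof.
move=> lp; have [k kl] := exists_dyadic_scale lp.
have k0 : 0 < (2 : R) ^+ k by rewrite exprn_gt0.
pose a0 := tfrac a.
pose j := Num.truncn (a0 * 2 ^+ k).
have a0p : 0 <= a0 * 2 ^+ k by rewrite mulr_ge0 ?tfrac_ge0// ltW.
have jle : j%:R <= a0 * 2 ^+ k by rewrite /j truncn_le.
have jlt : a0 * 2 ^+ k < j.+1%:R by exact: truncnS_gt.
have jk : (j < 2 ^ k)%N.
  rewrite -(ltr_nat R) natrX (le_lt_trans jle)// gtr_pMl//; exact: tfrac_lt1.
pose b : R := j%:R / 2 ^+ k.
pose d : R := (2 ^+ k)^-1.
have ba : b <= a0 by rewrite /b ler_pdivrMr.
have ab : a0 < b + d by rewrite /b /d -[X in _ + X]mul1r -mulrDl natr1 ltr_pdivlMr.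
(* The index of the next interval wraps to 0 at the end of the circle, but its left endpoint is kept
   as [b + d], possibly equal to 1. The inclusions of arcs then become inequalities between reals,
   free of wrap-around. *)
exists k, (fun i => if i then j else if (j.+1 < 2 ^ k)%N then j.+1 else 0%N).
exists (fun i => if i then b else b + d); rewrite -/d in kl *; split.
- by case => //; case: ifP => // _; rewrite /dyad_ok expn_gt0.
- case; first exact: dyad_tarc.
  case: ifP => h; first by rewrite dyad_tarc// /b -natr1 mulrDl mul1r.
  have {}h : (j.+1 = 2 ^ k)%N by apply/eqP; rewrite eqn_leq jk leqNgt h.
  rewrite dyad_tarc; last by rewrite /dyad_ok expn_gt0.
  have -> : b + d = 1.
    by rewrite /b /d -[X in _ + X]mul1r -mulrDl natr1 h natrX divff// gt_eqF.
  rewrite mul0r -[in RHS]tarc_tfrac; congr tarc.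
  by rewrite -[1]add0r (tfracDz 0 1) tfrac_id// lexx ltr01.
- move=> i; split => //.
    by rewrite -(tarc_tfrac a) -/a0; case: i; apply: tarc_sub; lra.
  have -> : tarc (a - l / 2 - l - 2 * l) (2 * (2 * (2 * l))) =
      tarc (a0 - l / 2 - l - 2 * l) (2 * (2 * (2 * l))).
    rewrite -[LHS]tarc_tfrac -[RHS]tarc_tfrac; congr tarc.
    have E x : x - l / 2 - l - 2 * l = x - 7 / 2 * l by lra.
    by rewrite !E; exact/esym/tfracD_tfrac.
  by case: i; apply: tarc_sub; lra.
- rewrite -(tarc_tfrac a) -/a0 => x [u [ul ->]].
  have [h|h] := ltP (a0 + u) (b + d); [left|right].
    by exists (a0 + u - b); split; [lra|congr tfrac; lra].
  by exists (a0 + u - (b + d)); split; [lra|congr tfrac; lra].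
Qed.

End Torus.

(** * Averages over a set of finite positive measure *)

Section Averages.
Variable R : realType.
Local Notation mu2 := (@mu2 R).
Implicit Types (E : set (R * R)) (f g : R * R -> \bar R).
Local Open Scope ereal_scope.

Definition finite_pos E := measurable E /\ exists2 m : R, (0 < m)%R & mu2 E = m%:E.

Lemma ae_imply (P P' : R * R -> Prop) : (forall z, P z -> P' z) ->
  {ae mu2, forall z, P z} -> {ae mu2, forall z, P' z}.
Proof.
by move=> PP' [A [mA A0 PA]]; exists A; split => // z nP; apply: PA => /PP'.
Qed.

Lemma ae_conj (P P' : R * R -> Prop) :
  {ae mu2, forall z, P z} -> {ae mu2, forall z, P' z} ->
  {ae mu2, forall z, P z /\ P' z}.
Proof.
move=> aP aP'; have [A [mA A0 PA]] := negligibleU aP aP'.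
exists A; split => // z /= nP; apply: PA => /=.
by have [|] := pselect (P z); [move=> Pz; right => P'z; apply: nP|left].
Qed.

Lemma avg_ge0 E f : (forall z, E z -> 0 <= f z) -> 0 <= avg E f.
Proof.
move=> f0; rewrite /avg mule_ge0//; first exact: integral_ge0.
by rewrite lee_fin invr_ge0 fine_ge0.
Qed.

Lemma le_avg_ae E f g : finite_pos E -> measurable_fun E f -> measurable_fun E g ->
  (forall z, E z -> 0 <= f z) -> (forall z, E z -> 0 <= g z) ->
  {ae mu2, forall z, E z -> f z <= g z} -> avg E f <= avg E g.
Proof.
move=> [mE [m m0 Em]] mf mg f0 g0 fg; rewrite /avg Em lee_wpmul2r//.
  by rewrite lee_fin invr_ge0 ltW.
exact: ae_ge0_le_integral.
Qed.

Lemma le_avg E f g : finite_pos E -> measurable_fun E f -> measurable_fun E g ->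
  (forall z, E z -> 0 <= f z) -> (forall z, E z -> f z <= g z) -> avg E f <= avg E g.
Proof.
move=> pE mf mg f0 fg; apply: le_avg_ae => //; last exact: aeW.
by move=> z Ez; rewrite (le_trans (f0 _ Ez))// fg.
Qed.

Lemma avgD E f g : finite_pos E -> measurable_fun E f -> measurable_fun E g ->
  (forall z, E z -> 0 <= f z) -> (forall z, E z -> 0 <= g z) ->
  avg E (fun z => f z + g z) = avg E f + avg E g.
Proof.
move=> [mE _] mf mg f0 g0; rewrite /avg ge0_integralD//.
by rewrite ge0_muleDl// integral_ge0.
Qed.

Lemma avgZl E f (k : \bar R) : finite_pos E -> measurable_fun E f ->
  (forall z, E z -> 0 <= f z) -> 0 <= k ->
  avg E (fun z => k * f z) = k * avg E f.
Proof. by move=> [mE _] mf f0 k0; rewrite /avg ge0_integralZl// muleA. Qed.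

Lemma avg_cst E (k : \bar R) : finite_pos E -> avg E (fun=> k) = k.
Proof.
move=> [mE [m m0 Em]]; have intk : \int[mu2]_(z in E) k = k * mu2 E by exact: integral_cst.
by rewrite /avg intk Em/= -muleA -EFinM divff ?mule1// gt_eqF.
Qed.

Lemma eq_avg E f g : (forall z, E z -> f z = g z) -> avg E f = avg E g.
Proof.
by move=> fg; rewrite /avg; congr (_ * _); apply: eq_integral => z /[!inE]/fg.
Qed.

Lemma le_avg_cst E f (k : R) : finite_pos E -> measurable_fun E f ->
  (forall z, E z -> 0 <= f z) -> (forall z, E z -> f z <= k%:E) -> avg E f <= k%:E.
Proof. by move=> pE mf f0 fk; rewrite -(avg_cst k%:E pE) le_avg. Qed.

Lemma avg_fin E f (k : R) : finite_pos E -> measurable_fun E f ->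
  (forall z, E z -> 0 <= f z) -> (forall z, E z -> f z <= k%:E) ->
  exists2 F : R, (0 <= F)%R & avg E f = F%:E.
Proof.
move=> pE mf f0 fk; exists (fine (avg E f)); first by rewrite fine_ge0// avg_ge0.
rewrite fineK// ge0_fin_numE ?avg_ge0//.
by rewrite (le_lt_trans (le_avg_cst pE mf f0 fk))// ltry.
Qed.

(** Monotone convergence for the truncations. It allows the test functions to stay bounded, hence to
    have finite averages, until the last moment. *)
Lemma le_avg_truncation E f (B : \bar R) : finite_pos E -> measurable_fun E f ->
  (forall z, E z -> 0 <= f z) ->
  (forall n : nat, avg E (fun z => mine (f z) n%:R%:E) <= B) -> avg E f <= B.
Proof.
move=> pE mf f0 fB; have [mE [m m0 Em]] := pE.
have mfn n : measurable_fun E (fun z => mine (f z) n%:R%:E).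
  by apply: measurable_mine => //; exact: measurable_cst.
have fn0 n z : E z -> 0 <= mine (f z) n%:R%:E.
  by move=> /f0 fz; rewrite le_min fz lee_fin/=.
have ndf z : E z -> {homo (fun n => mine (f z) n%:R%:E) : a b / (a <= b)%N >-> a <= b}.
  move=> _ a b ab; rewrite le_min ge_min lexx/= ge_min lee_fin ler_nat ab orbT//.
have fE z : f z = limn (fun n => mine (f z) n%:R%:E).
  apply/esym/cvg_lim => //; case: (f z) => [r| |].
  - apply: cvg_near_cst; exists (Num.truncn r).+1 => // n /= rn.
    apply/min_idPl; rewrite lee_fin ltW// (lt_le_trans (truncnS_gt r))//.
    by rewrite ler_nat.
  - rewrite (_ : (fun _ => _) = (fun n => n%:R%:E)); last first.
      by apply/funext => n; apply/min_idPr; rewrite leey.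
    exact/cvgenyP.
  - by apply: cvg_near_cst; near=> n; apply/min_idPl; rewrite leNye.
have intE : \int[mu2]_(z in E) f z =
    limn (fun n => \int[mu2]_(z in E) mine (f z) n%:R%:E).
  by rewrite -monotone_convergence//; apply: eq_integral => z _; exact: fE.
rewrite /avg Em/= intE lee_pdivrMr//; apply: lime_le.
  apply: ereal_nondecreasing_is_cvgn => a b ab.
  apply: ge0_le_integral.
  - exact: mE.
  - by move=> z Ez; exact: fn0.
  - exact: mfn.
  - exact: mfn.
  - by move=> z Ez; exact: ndf.
apply: nearW => n; rewrite -lee_pdivrMr//.
by have := fB n; rewrite /avg Em.
Unshelve. all: by end_near. Qed.

End Averages.

(** * Doubling weights on comparable rectangles *)

Section Doubling.
Variable R : realType.
Local Notation mu2 := (@mu2 R).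
Implicit Types (a b d l C : R) (u : R -> R -> R).
Local Open Scope ereal_scope.

Definition plane (u : R -> R -> R) : R * R -> \bar R := wf (fun x y => (u x y)%:E).

Definition nonneg_measurable u :=
  measurable_fun setT (fun z : R * R => u z.1 z.2) /\ forall x y, (0 <= u x y)%R.

Lemma measurable_plane u D : nonneg_measurable u -> measurable_fun D (plane u).
Proof. by move=> [mu _]; apply: measurable_funTS; exact/measurable_EFinP. Qed.

Lemma plane_ge0 u z : nonneg_measurable u -> 0 <= plane u z.
Proof. by move=> [_ u0]; rewrite lee_fin. Qed.

Lemma finite_pos_rect a1 l1 a2 l2 : rect_param l1 l2 -> finite_pos (rect a1 l1 a2 l2).
Proof.
move=> lp; split; first exact: measurable_rect.
exists (l1 * l2)%R; last exact: measure_rect.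
by move: lp => [/andP[? _] /andP[? _]]; exact: mulr_gt0.
Qed.

Lemma le_integral_subset u (A B : set (R * R)) : nonneg_measurable u ->
  measurable A -> measurable B -> A `<=` B ->
  \int[mu2]_(z in A) plane u z <= \int[mu2]_(z in B) plane u z.
Proof.
move=> gu mA mB AB; apply: ge0_subset_integral => //; first exact: measurable_plane.
by move=> z _; exact: plane_ge0.
Qed.

Lemma doubling_le C C' u : nonneg_measurable u -> (C <= C')%R ->
  doubling C (fun x y => (u x y)%:E) -> doubling C' (fun x y => (u x y)%:E).
Proof.
move=> gu CC' du a1 l1 a2 l2 lp; apply: (le_trans (du a1 l1 a2 l2 lp)).
rewrite lee_wpmul2r ?lee_fin//; apply: integral_ge0 => z _; exact: plane_ge0.
Qed.

(** Doubling is assumed for lengths at most 1, but iterating it leaves that range. Past 1 the arc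
    and its double are both the whole circle, so [l' = 1] may stand in for [l]. *)
Lemma doubling_arc_reduction a l : (0 < l)%R -> exists2 l' : R, (0 < l' <= 1)%R &
  tarc (a - l / 2) (2 * l) = tarc (a - l' / 2) (2 * l') /\ tarc a l = tarc a l'.
Proof.
move=> l0; have [l1|l1] := leP l 1%R; first by exists l => //; rewrite l0.
exists 1%R; first by lra.
by split; rewrite !tarc_full//; lra.
Qed.

Lemma doubling_all C u a1 l1 a2 l2 : doubling C (fun x y => (u x y)%:E) ->
  (0 < l1)%R -> (0 < l2)%R ->
  \int[mu2]_(z in rect (a1 - l1 / 2) (2 * l1) (a2 - l2 / 2) (2 * l2)) plane u z
  <= C%:E * \int[mu2]_(z in rect a1 l1 a2 l2) plane u z.
Proof.
move=> du l10 l20; rewrite /rect.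
have [l1' l1p [-> ->]] := doubling_arc_reduction a1 l10.
have [l2' l2p [-> ->]] := doubling_arc_reduction a2 l20.
exact: du.
Qed.

Lemma doubling2 C u a1 l1 a2 l2 : (0 <= C)%R -> doubling C (fun x y => (u x y)%:E) ->
  (0 < l1)%R -> (0 < l2)%R ->
  \int[mu2]_(z in rect (a1 - l1 / 2 - l1) (2 * (2 * l1))
                       (a2 - l2 / 2 - l2) (2 * (2 * l2))) plane u z
  <= (C ^+ 2)%:E * \int[mu2]_(z in rect a1 l1 a2 l2) plane u z.
Proof.
move=> C0 du l10 l20.
(* The second doubling moves the left endpoint by half of the current length [2 * l]. *)
have E (a l : R) : (a - l / 2 - l = a - l / 2 - (2 * l) / 2)%R by lra.
rewrite (E a1) (E a2).
apply: (le_trans (doubling_all (a1 - l1 / 2) (a2 - l2 / 2) du (_ : 0 < 2 * l1)%R (_ : 0 < 2 * l2)%R)).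
- by lra.
- by lra.
rewrite expr2 EFinM -muleA lee_wpmul2l// ?lee_fin//.
exact: doubling_all.
Qed.

Lemma doubling3 C u a1 l1 a2 l2 : (0 <= C)%R -> doubling C (fun x y => (u x y)%:E) ->
  (0 < l1)%R -> (0 < l2)%R ->
  \int[mu2]_(z in rect (a1 - l1 / 2 - l1 - 2 * l1) (2 * (2 * (2 * l1)))
                       (a2 - l2 / 2 - l2 - 2 * l2) (2 * (2 * (2 * l2)))) plane u z
  <= (C ^+ 3)%:E * \int[mu2]_(z in rect a1 l1 a2 l2) plane u z.
Proof.
move=> C0 du l10 l20.
have E (a l : R) : (a - l / 2 - l - 2 * l = a - l / 2 - l - (2 * (2 * l)) / 2)%R by lra.
rewrite (E a1) (E a2).
apply: (le_trans (doubling_all (a1 - l1 / 2 - l1) (a2 - l2 / 2 - l2) du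
  (_ : 0 < 2 * (2 * l1))%R (_ : 0 < 2 * (2 * l2))%R)).
- by lra.
- by lra.
by rewrite exprS EFinM -muleA lee_wpmul2l ?lee_fin// doubling2.
Qed.

(** The third clause is the area bound [|D| <= 4 |Q|] in the form needed to sum over a cover. [f]
    and [u] are quantified inside because a cover depends on the rectangle only. *)
Definition comparable_rect (Q D : set (R * R)) :=
  [/\ dyad_rects D, finite_pos D,
      forall f : R * R -> \bar R, measurable_fun setT f -> (forall z, 0 <= f z) ->
        \int[mu2]_(z in D) f z <= (4 * fine (mu2 Q))%:E * avg D f &
      forall C u, (1 <= C)%R -> doubling C (fun x y => (u x y)%:E) -> nonneg_measurable u ->
        avg Q (plane u) <= (4 * C ^+ 2)%:E * avg D (plane u) /\
        avg D (plane u) <= (C ^+ 3)%:E * avg Q (plane u)].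

(** From [l <= d < 2 l] in each variable, [|Q| <= |D| <= 4 |Q|]. Two doublings of [D] contain [Q]
    and three doublings of [Q] contain [D]; together with the area ratios this gives [4 C^2] and
    [C^3]. *)
Lemma close_rect a1 l1 a2 l2 k1 j1 b1 k2 j2 b2 : rect_param l1 l2 ->
  dyad_ok k1 j1 -> dyad_ok k2 j2 ->
  dyad k1 j1 = tarc b1 (2 ^+ k1)^-1 -> dyad k2 j2 = tarc b2 (2 ^+ k2)^-1 ->
  close_arcs a1 l1 b1 (2 ^+ k1)^-1 -> close_arcs a2 l2 b2 (2 ^+ k2)^-1 ->
  comparable_rect (rect a1 l1 a2 l2) (dyad_rect k1 j1 k2 j2).
Proof.
move=> lp ok1 ok2 e1 e2.
have d1p : (0 < ((2 : R) ^+ k1)^-1 <= 1)%R.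
  by rewrite invr_gt0 exprn_gt0//= invf_le1 ?exprn_gt0// exprn_ege1// ler1n.
have d2p : (0 < ((2 : R) ^+ k2)^-1 <= 1)%R.
  by rewrite invr_gt0 exprn_gt0//= invf_le1 ?exprn_gt0// exprn_ege1// ler1n.
have DE : dyad_rect k1 j1 k2 j2 = rect b1 (2 ^+ k1)^-1 b2 (2 ^+ k2)^-1.
  by rewrite /dyad_rect e1 e2.
move: (2 ^+ k1)^-1%R (2 ^+ k2)^-1%R d1p d2p DE => d1 d2 d1p d2p DE c1 c2.
have dp : rect_param d1 d2 by split.
case: c1 => ld1 s1 t1; case: c2 => ld2 s2 t2.
have [l10 l20] : (0 < l1 /\ 0 < l2)%R by case: lp => /andP[? _] /andP[].
have [d10 d20] : (0 < d1 /\ 0 < d2)%R by case: dp => /andP[? _] /andP[].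
have ld : (l1 * l2 <= d1 * d2)%R by apply: ler_pM; lra.
have dl : (d1 * d2 <= 4 * (l1 * l2))%R.
  by rewrite (_ : 4 * (l1 * l2) = (2 * l1) * (2 * l2))%R; [apply: ler_pM; lra|lra].
have l12 : (0 < l1 * l2)%R by exact: mulr_gt0.
have d12 : (0 < d1 * d2)%R by exact: mulr_gt0.
rewrite DE; split.
- by exists k1, j1, k2, j2; rewrite -DE.
- exact: finite_pos_rect.
- move=> f mf f0; rewrite /avg measure_rect// measure_rect//= muleCA.
  rewrite lee_pemulr//; first exact: integral_ge0.
  by rewrite -EFinM lee_fin ler_pdivlMr ?mul1r.
- move=> C u C1 du gu.
  have C0 : (0 <= C)%R by lra.
  have i0 E : 0 <= \int[mu2]_(z in E) plane u z.
    by apply: integral_ge0 => z _; exact: plane_ge0.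
  rewrite /avg measure_rect// measure_rect//=; split.
    rewrite lee_pdivrMr//.
    apply: (@le_trans _ _ ((C ^+ 2)%:E * \int[mu2]_(z in rect b1 d1 b2 d2) plane u z)).
      apply: (le_trans _ (doubling2 b1 b2 C0 du d10 d20)).
      by apply: le_integral_subset; [|exact: measurable_rect..|exact: rect_subset].
    have -> : forall I, (4 * C ^+ 2)%:E * (I * (d1 * d2)^-1%:E) * (l1 * l2)%:E =
        (C ^+ 2)%:E * (I * (4 * (l1 * l2) / (d1 * d2))%:E).
      move=> I; rewrite -!muleA -EFinM muleCA -EFinM [in RHS]muleCA -EFinM.
      by congr (_ * _%:E); ring.
    rewrite lee_wpmul2l ?lee_fin ?exprn_ge0// lee_pemulr//.
    by rewrite lee_fin ler_pdivlMr ?mul1r.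
  rewrite lee_pdivrMr//.
  apply: (@le_trans _ _ ((C ^+ 3)%:E * \int[mu2]_(z in rect a1 l1 a2 l2) plane u z)).
    apply: (le_trans _ (doubling3 a1 a2 C0 du l10 l20)).
    by apply: le_integral_subset; [|exact: measurable_rect..|exact: rect_subset].
  rewrite -!muleA lee_wpmul2l ?lee_fin ?exprn_ge0// lee_pemulr//.
  by rewrite -EFinM lee_fin mulrC ler_pdivlMr ?mul1r.
Qed.

Lemma rect_cover a1 l1 a2 l2 : rect_param l1 l2 -> exists D : bool -> bool -> set (R * R),
  rect a1 l1 a2 l2 `<=` (D true true `|` D true false) `|` (D false true `|` D false false) /\
  forall i j, comparable_rect (rect a1 l1 a2 l2) (D i j).
Proof.
move=> lp; have [lp1 lp2] := lp.
have [k1 [j1 [b1 [ok1 e1 c1 s1]]]] := dyadic_arc_cover a1 lp1.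
have [k2 [j2 [b2 [ok2 e2 c2 s2]]]] := dyadic_arc_cover a2 lp2.
exists (fun i i' => dyad_rect k1 (j1 i) k2 (j2 i')); split; last first.
  by move=> i i'; apply: (close_rect lp (ok1 i) (ok2 i') (e1 i) (e2 i')).
move=> z [/s1 z1 /s2 z2]; rewrite /dyad_rect !e1 !e2.
by case: z1 => z1; case: z2 => z2; [left; left|left; right|right; left|right; right]; split.
Qed.

(** Subadditivity rather than additivity, because rectangles of a cover may coincide: at scale
    [k = 0] both dyadic arcs are the whole circle. *)
Lemma integral_setU_le (A B : set (R * R)) (f : R * R -> \bar R) :
  measurable A -> measurable B -> measurable_fun setT f -> (forall z, 0 <= f z) ->
  \int[mu2]_(z in A `|` B) f z <= \int[mu2]_(z in A) f z + \int[mu2]_(z in B) f z.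
Proof.
move=> mA mB mf f0; rewrite -(setDUK (@subsetUl _ A B)) ge0_integral_setU//; last first.
- by rewrite disj_set2E setDIK.
- exact: measurable_funTS.
- by apply: measurableD => //; exact: measurableU.
rewrite leeD2l//; apply: ge0_subset_integral => //.
- by apply: measurableD => //; exact: measurableU.
- exact: measurable_funTS.
- by move=> z [[]].
Qed.

(** The constant 16 is the number of rectangles, four, times the bound 4 on the area ratio. *)
Lemma le_avg_cover a1 l1 a2 l2 (D : bool -> bool -> set (R * R)) f (B : \bar R) :
  rect_param l1 l2 ->
  rect a1 l1 a2 l2 `<=` (D true true `|` D true false) `|` (D false true `|` D false false) ->
  (forall i j, comparable_rect (rect a1 l1 a2 l2) (D i j)) ->
  measurable_fun setT f -> (forall z, 0 <= f z) -> 0 <= B ->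
  (forall i j, avg (D i j) f <= B) -> avg (rect a1 l1 a2 l2) f <= 16%:E * B.
Proof.
move=> lp QD cD mf f0 B0 fB.
have mD i j : measurable (D i j) by case: (cD i j) => _ [].
have l12 : (0 < l1 * l2)%R by case: lp => /andP[? _] /andP[? _]; exact: mulr_gt0.
have fD i j : \int[mu2]_(z in D i j) f z <= (4 * (l1 * l2))%:E * B.
  case: (cD i j) => _ _ /(_ f mf f0) + _; rewrite measure_rect//= => /le_trans; apply.
  by rewrite lee_wpmul2l// lee_fin; lra.
rewrite /avg measure_rect// lee_pdivrMr//.
have mU i : measurable (D i true `|` D i false) by exact: measurableU.
apply: (@le_trans _ _ (\int[mu2]_(z in (D true true `|` D true false) `|`
    (D false true `|` D false false)) f z)).
  apply: ge0_subset_integral .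
  - exact: measurable_rect.
  - exact: (measurableU _ _ (mU true) (mU false)).
  - exact: measurable_funTS.
  - by [].
  - exact: QD.
apply: (le_trans (integral_setU_le _ _ _ _)) => //.
have -> : 16%:E * B * (l1 * l2)%:E = ((4 * (l1 * l2))%:E * B + (4 * (l1 * l2))%:E * B) +
    ((4 * (l1 * l2))%:E * B + (4 * (l1 * l2))%:E * B).
  rewrite -!ge0_muleDl ?lee_fin//; [|by lra..].
  by rewrite muleAC -EFinM -!EFinD; congr (_%:E * _); lra.
by apply: leeD; (apply: (le_trans (integral_setU_le _ _ _ _)) => //; exact: leeD).
Qed.

End Doubling.

(** * Pointwise inequalities *)

Section Pointwise.
Variable R : realType.
Implicit Types x y : \bar R.

Lemma powRK (x r : R) : 0 <= x -> 0 < r -> (x `^ r) `^ r^-1 = x.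
Proof. by move=> x0 r0; rewrite -powRrM divff ?powRr1// gt_eqF. Qed.

Lemma powRVK (x r : R) : 0 <= x -> 0 < r -> (x `^ r^-1) `^ r = x.
Proof. by move=> x0 r0; rewrite -powRrM mulVf ?powRr1// gt_eqF. Qed.

(* Young's inequality without the sharp constant: split according to whether
   [t * u * f ^ (r - 1)] is at least one. *)
Lemma young_Ap (r t f u : R) : 1 < r -> 0 < t -> 0 <= f -> 0 <= u ->
  (f%:E <= (t * (f `^ r * u))%:E +
           ((t^-1) `^ (r - 1)^-1)%:E * poweR (u%:E)^-1 (r - 1)^-1)%E.
Proof.
move=> r1 t0 f0 u0.
have r10 : 0 < r - 1 by lra.
have r1i : 0 < (r - 1)^-1 by rewrite invr_gt0.
have ti0 : 0 < t^-1 `^ (r - 1)^-1 by rewrite powR_gt0 ?invr_gt0.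
move: u0; rewrite le_eqVlt => /predU1P[<-|u0].
  by rewrite inve0 poweRyr ?gt_eqF// gt0_muley ?lte_fin// addey ?leey.
rewrite inver gt_eqF// poweR_EFin -EFinM -EFinD lee_fin -powRM; last 2 first.
- by rewrite invr_ge0 ltW.
- by rewrite invr_ge0 ltW.
have f1 : 0 <= f `^ (r - 1) by exact: powR_ge0.
have fr : f * f `^ (r - 1) = f `^ r by rewrite mulr_powRB1//; lra.
have p0 : 0 <= (t^-1 / u) `^ (r - 1)^-1 by exact: powR_ge0.
have tu0 : 0 < t * u by exact: mulr_gt0.
have [h|h] := leP 1 (t * u * f `^ (r - 1)).
  have : f * 1 <= f * (t * u * f `^ (r - 1)) by exact: ler_wpM2l.
  have -> : f * (t * u * f `^ (r - 1)) = t * (f `^ r * u) by rewrite -fr; ring.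
  by lra.
have t1 : 0 <= t * (f `^ r * u) by rewrite !mulr_ge0 ?powR_ge0// ltW.
suff : f <= (t^-1 / u) `^ (r - 1)^-1 by lra.
rewrite -[leLHS](powRK f0 r10); apply: ge0_ler_powR.
- exact: ltW.
- by rewrite nnegrE.
- by rewrite nnegrE mulr_ge0// invr_ge0 ltW.
by rewrite -invfM -[leRHS]mul1r ler_pdivlMr// mulrC ltW.
Qed.

(** Replacing the smaller of [u] and [v] by the larger bounds the product by a single power, with no
    conjugate exponents. *)
Lemma young_RH (p u v : R) : 1 < p -> 0 <= u -> 0 <= v ->
  v `^ (p - 1) * u <= u `^ p + v `^ p.
Proof.
move=> p1 u0 v0.
have up : u `^ (p - 1) * u = u `^ p by rewrite mulrC mulr_powRB1//; lra.
have vp : v `^ (p - 1) * v = v `^ p by rewrite mulrC mulr_powRB1//; lra.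
have := powR_ge0 u p; have := powR_ge0 v p.
have [uv|uv] := leP u v.
  have : v `^ (p - 1) * u <= v `^ (p - 1) * v by rewrite ler_wpM2l// powR_ge0.
  by lra.
have : v `^ (p - 1) * u <= u `^ (p - 1) * u.
  by rewrite ler_wpM2r//; apply: ge0_ler_powR; rewrite ?nnegrE//; lra.
by lra.
Qed.

Lemma measurable_lne : measurable_fun setT (@lne R).
Proof.
rewrite (_ : @lne R = fun x => if (x <= 0)%E then -oo%E else er_map (@ln R) x).
  apply: measurable_fun_ifT; first exact: measurable_fun_lee.
    exact: measurable_cst.
  exact: (@measurable_er_map _ (measurableTypeR R) R (@ln R) (@measurable_ln R)).
by apply/funext => -[x| |]//=; rewrite ?lee_fin ?leye_eq ?leNye//; case: ifP.
Qed.

(** On nonnegative values inversion agrees with [inv], which is assembled from measurable pieces on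
    the whole extended line. *)
Lemma measurable_inve_comp d (T : measurableType d) (D : set T) (f : T -> \bar R) :
  measurable D -> measurable_fun D f -> (forall z, D z -> 0 <= f z)%E ->
  measurable_fun D (fun z => (f z)^-1)%E.
Proof.
move=> mD mf f0.
pose inv (x : \bar R) : \bar R := if (x <= 0)%E then +oo%E else
  if x == +oo%E then 0%E else ((fine x) `^ (-1))%:E.
have minv : measurable_fun setT inv.
  apply: measurable_fun_ifT; first exact: measurable_fun_lee.
    exact: measurable_cst.
  apply: measurable_fun_ifT; first exact: measurable_fun_eqe.
    exact: measurable_cst.
  apply/measurable_EFinP.
  apply: (measurableT_comp (@measurable_powR R (-1))).
  exact: fine_measurable.
apply: (eq_measurable_fun (inv \o f)); last exact: measurableT_comp.
move=> z /[!inE] /f0; rewrite /inv /=; case: (f z) => [x| |]//=.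
rewrite lee_fin => x0; rewrite lee_fin inver.
have [->|xn0] := eqVneq x 0; first by rewrite lexx.
by rewrite leNgt lt_neqAle eq_sym xn0 x0/= powR_inv1.
Qed.

(* The positive part of [log (c / x)], equal to [+oo] at [x = 0]. *)
Definition log_plus (c : R) x : \bar R := (maxe 0 ((ln c)%:E - lne x))%E.

Lemma measurable_log_plus c : measurable_fun setT (log_plus c).
Proof.
apply: measurable_maxe; first exact: measurable_cst.
apply: emeasurable_funB; first exact: measurable_cst.
exact: measurable_lne.
Qed.

Lemma log_plus_ge0 c x : (0 <= log_plus c x)%E.
Proof. by rewrite le_max lexx. Qed.

(** Changing the normalisation costs at most [ln k]. In the application [c] and [c'] are the
    averages over a rectangle and over a dyadic rectangle of its cover. *)
Lemma log_plus_le_mul (c c' k x : R) : 0 < c -> 0 < c' -> 1 <= k -> c <= k * c' ->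
  0 <= x -> (log_plus c x%:E <= (ln k)%:E + log_plus c' x%:E)%E.
Proof.
move=> c0 c'0 k1 ck x0; rewrite /log_plus /=.
have lk : ln c <= ln k + ln c'.
  by rewrite -lnM ?posrE//; [rewrite ler_ln ?posrE ?mulr_gt0//; lra|lra].
have k0 : 0 <= ln k by rewrite ln_ge0.
case: ifPn => xx; first by rewrite /= !addey// !max_r ?leey// addey ?leey.
rewrite -!EFinB -!EFin_max -EFinD lee_fin !maxEle.
by do 2 case: ifPn; rewrite -?ltNge => *; lra.
Qed.

(** This is [log^+ (c / x) <= log (c / x) + x / c], true because the negative part of [log (c / x)]
    is at most [x / c]. Each logarithm is split into its two parts and the negative parts change
    sides, so that only nonnegative terms have to be averaged. *)
Lemma log_plus_defect (c x : R) : 0 < c -> 0 <= x ->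
  (log_plus c x%:E + maxe (- lne (x%:E)^-1) 0 + (Num.max 0 (- ln c))%:E <=
   maxe (lne (x%:E)^-1) 0 + (x / c)%:E + (Num.max 0 (ln c))%:E)%E.
Proof.
move=> c0; rewrite le_eqVlt => /predU1P[<-|x0].
  by rewrite inve0 [leRHS](_ : _ = +oo%E) ?leey//= max_l ?leey// !addye.
rewrite inver gt_eqF// lne_EFin ?invr_gt0// lnV ?posrE// /log_plus lne_EFin//.
have -> : x / c = expR (ln x - ln c).
  by rewrite expRD expRN !lnK ?posrE.
set y := ln x; set k := ln c.
have h1 := expR_ge1Dx (y - k); have h2 := expR_gt0 (y - k).
rewrite -!EFinB -!EFinN -!EFin_max -!EFinD lee_fin !maxEle.
by do 5 case: ifPn; rewrite -?ltNge => *; lra.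
Qed.

(** The bound [log (c / x) <= log^+ (c / x)], with the negative parts moved across for the same
    reason. *)
Lemma neg_lne_inv_le (c : R) (x : \bar R) : 0 < c -> (0 <= x)%E ->
  (maxe (lne x^-1) 0 + (Num.max 0 (ln c))%:E <=
   log_plus c x + maxe (- lne x^-1) 0 + (Num.max 0 (- ln c))%:E)%E.
Proof.
move=> c0; case: x => [x| |]//; last first.
  move=> _; rewrite invey [leRHS](_ : _ = +oo%E) ?leey//=.
  rewrite lexx/= [X in (_ + X + _)%E]max_l ?leey// addey ?addye.
rewrite lee_fin le_eqVlt => /predU1P[<-|x0].
  rewrite inve0 [leRHS](_ : _ = +oo%E) ?leey//= /log_plus/= lexx/= addey//.
  by rewrite [X in (X + _ + _)%E]max_r ?leey// [X in (_ + X + _)%E]max_r ?leNye// adde0 addye.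
rewrite inver gt_eqF// lne_EFin ?invr_gt0// lnV ?posrE// /log_plus lne_EFin//.
rewrite -!EFinB -!EFinN -!EFin_max -!EFinD lee_fin !maxEle.
by do 5 case: ifPn; rewrite -?ltNge => *; lra.
Qed.

(** [log x <= x]. It makes the negative part of [log (1 / W)] integrable as soon as [W] is. *)
Lemma neg_lne_inv_le_id (x : \bar R) : (0 <= x)%E -> (maxe (- lne x^-1) 0 <= x)%E.
Proof.
case: x => [x| |]//; last by move=> _; rewrite leey.
rewrite lee_fin le_eqVlt => /predU1P[<-|x0].
  by rewrite inve0/= max_r ?leNye.
rewrite inver gt_eqF// lne_EFin ?invr_gt0// lnV ?posrE// -EFinN opprK -EFin_max lee_fin.
by rewrite ge_max (ltW x0) andbT ltW// ln_sublinear.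
Qed.

(* The tangent line of the exponential at [c]. *)
Lemma tangent_exp (k c h x : R) : 0 < k -> 0 <= c -> 0 <= h -> 0 <= x ->
  ((k * expR c)%:E * (1 + h)%:E <=
   (expR h * x)%:E + (k * expR c)%:E * (log_plus k x%:E + c%:E))%E.
Proof.
move=> k0 c0 h0.
have kc : 0 < k * expR c by rewrite mulr_gt0// expR_gt0.
rewrite le_eqVlt => /predU1P[<-|x0].
  by rewrite /log_plus/= lexx addey// max_r ?leey// addye// gt0_muley ?lte_fin// addey// leey.
rewrite /log_plus lne_EFin// -EFinB -EFin_max.
rewrite -!(EFinD, EFinM) lee_fin.
set l := Num.max _ _.
(* This trades [x] for its logarithm; what remains is [1 + v <= expR v] at [v = h - l - c]. *)
have xl : k * expR (- l) <= x.
  rewrite -[leRHS]lnK ?posrE// -{1}(lnK (_ : k \is Num.pos)) ?posrE// -expRD ler_expR.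
  have : ln k - ln x <= l by rewrite /l le_max lexx orbT.
  by lra.
have h1 := expR_ge1Dx (h - l - c).
have h2 : expR h * (k * expR (- l)) <= expR h * x.
  by rewrite ler_wpM2l// expR_ge0.
have e1 : expR h * (k * expR (- l)) = k * expR c * expR (h - l - c).
  rewrite !expRD [expR (- c)]expRN; field; exact: lt0r_neq0 (expR_gt0 _).
have h3 : k * expR c * (1 + (h - l - c)) <= k * expR c * expR (h - l - c).
  by rewrite ler_wpM2l// ltW.
rewrite e1 in h2.
have -> : k * expR c * (1 + h) = k * expR c * (1 + (h - l - c)) + k * expR c * (l + c) by ring.
lra.
Qed.

(** For finite positive [x] the assumption gives [expR h <= max (1, k / x)], hence
    [expR h * x <= max (x, k)]. *)
Lemma expR_log_plus_mul_le (k : R) (x : \bar R) (h : R) : 0 < k -> (0 <= x)%E ->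
  0 <= h -> (h%:E <= log_plus k x)%E -> ((expR h)%:E * x <= k%:E + x)%E.
Proof.
move=> k0 x0 h0; case: x x0 => [x| |]//; last first.
  by move=> _ _; rewrite addey// leey.
rewrite lee_fin le_eqVlt => /predU1P[<- _|x0].
  by rewrite mule0 adde0 lee_fin ltW.
rewrite /log_plus lne_EFin// -EFinB -EFin_max lee_fin -EFinM -EFinD lee_fin => hl.
have : expR h <= Num.max 1 (k / x).
  rewrite (le_trans (_ : _ <= expR (Num.max 0 (ln k - ln x))))// ?ler_expR//.
  have [e|e] := leP (ln k - ln x) 0; first by rewrite expR0 le_max lexx.
  by rewrite expRD expRN !lnK ?posrE// le_max lexx orbT.
rewrite le_max => /orP[e|e].
  have : expR h * x <= 1 * x by rewrite ler_wpM2r// ltW.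
  by lra.
have : expR h * x <= k / x * x by rewrite ler_wpM2r// ltW.
by rewrite divfK ?gt_eqF//; lra.
Qed.

End Pointwise.

(** * Inequalities linear in the weight *)

Section Linear.
Variable R : realType.
Local Notation mu2 := (@mu2 R).
Implicit Types (E Q : set (R * R)) (u : R -> R -> R).
Local Open Scope ereal_scope.

Lemma powR_invl (x r : R) : (0 <= x)%R -> (x^-1 `^ r = (x `^ r)^-1)%R.
Proof. by move=> x0; rewrite -[x^-1%R]powR_inv1// -powRrM mulN1r powRN. Qed.

(** Hölder's inequality with a loss of [2 ^ r]. Averaging [young_Ap] bounds [F] by a multiple of
    [avg (f ^ r * u)] plus a dual term; the free parameter makes the dual term at most [F / 2],
    which is absorbed on the left. *)
Lemma Ap_linear E u (r K wE F : R) (f : R * R -> R) : finite_pos E ->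
  nonneg_measurable u -> (1 < r)%R -> (0 < K)%R -> (0 < wE)%R ->
  avg E (fun z => poweR (plane u z)^-1 (r - 1)^-1) <= ((K / wE) `^ (r - 1)^-1)%:E ->
  measurable_fun setT f -> (forall z, 0 <= f z)%R ->
  avg E (fun z => (f z)%:E) = F%:E -> (0 <= F)%R ->
  ((F / 2) `^ r * wE)%:E <= K%:E * avg E (fun z => (f z `^ r * u z.1 z.2)%:E).
Proof.
move=> pE gu r1 K0 w0 sE mf f0 fF F0; have [mE _] := pE; have [mu u0] := gu.
have g0 : 0 <= K%:E * avg E (fun z => (f z `^ r * u z.1 z.2)%:E).
  rewrite mule_ge0//; first by rewrite lee_fin ltW.
  by apply: avg_ge0 => z _; rewrite lee_fin mulr_ge0// powR_ge0.
move: F0; rewrite le_eqVlt => /predU1P[F0|F0].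
  by rewrite -F0 mul0r powR0 ?mul0r// gt_eqF//; lra.
have r10 : (0 < r - 1)%R by lra.
(* Solves [(t^-1 * (K / wE)) ^ (1 / (r - 1)) = F / 2]. *)
pose t := (K / wE / (F / 2) `^ (r - 1))%R.
have F20 : (0 < F / 2)%R by lra.
have t0 : (0 < t)%R by rewrite /t !divr_gt0// powR_gt0.
have msig : measurable_fun E (fun z => poweR (plane u z)^-1 (r - 1)^-1).
  apply: (measurableT_comp (measurable_poweR _)).
  by apply: measurable_inve_comp => //; [exact: measurable_plane|move=> z _; exact: plane_ge0].
have mfr : measurable_fun E (fun z => (f z `^ r * u z.1 z.2)%:E).
  apply: measurable_funTS; apply/measurable_EFinP; apply: measurable_funM => //.
  exact: (measurableT_comp (measurable_powR _)).
have key : F%:E <= t%:E * avg E (fun z => (f z `^ r * u z.1 z.2)%:E) +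
    (t^-1 `^ (r - 1)^-1)%:E * avg E (fun z => poweR (plane u z)^-1 (r - 1)^-1).
  rewrite -fF -avgZl//; [|by move=> z _; rewrite lee_fin mulr_ge0// powR_ge0|by rewrite lee_fin ltW].
  rewrite -avgZl//; [|by move=> z _; exact: poweR_ge0|by rewrite lee_fin powR_ge0].
  rewrite -avgD//.
  - apply: le_avg; first exact: pE.
    + by apply: measurable_funTS; exact/measurable_EFinP.
    + by apply: emeasurable_funD; exact: measurable_funeM.
    + by move=> z _; rewrite lee_fin.
    + by move=> z _; rewrite -EFinM; exact: young_Ap.
  - exact: measurable_funeM.
  - exact: measurable_funeM.
  - move=> z _; rewrite -EFinM lee_fin; apply: mulr_ge0; first exact: ltW.
    by rewrite mulr_ge0// powR_ge0.
  - by move=> z _; rewrite mule_ge0 ?poweR_ge0// lee_fin powR_ge0.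
have half : (t^-1 `^ (r - 1)^-1)%:E * avg E (fun z => poweR (plane u z)^-1 (r - 1)^-1)
    <= (F / 2)%:E.
  apply: (@le_trans _ _ ((t^-1 `^ (r - 1)^-1)%:E * ((K / wE) `^ (r - 1)^-1)%:E)).
    by rewrite lee_wpmul2l// lee_fin powR_ge0.
  rewrite -EFinM lee_fin -powRM; [|by rewrite invr_ge0 ltW|by rewrite divr_ge0// ltW].
  have -> : (t^-1 * (K / wE) = (F / 2) `^ (r - 1))%R.
    by rewrite /t invf_div divfK// gt_eqF// divr_gt0.
  by rewrite powRK// ltW.
move: g0 key; case: (avg E (fun z => (f z `^ r * u z.1 z.2)%:E)) => [B| |] => g0 key.
- have {}key : (F <= t * B + F / 2)%R.
    rewrite -lee_fin EFinD EFinM; apply: (le_trans key); exact: leeD2l.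
  have {}key : (F / 2 <= t * B)%R by lra.
  rewrite -EFinM lee_fin -mulr_powRB1 ?(ltW F20)//; last by lra.
  have p0 : (0 < (F / 2) `^ (r - 1))%R by rewrite powR_gt0.
  have : (F / 2 * ((F / 2) `^ (r - 1) * wE) <= t * B * ((F / 2) `^ (r - 1) * wE))%R.
    by rewrite ler_wpM2r// mulr_ge0 ?powR_ge0// ltW.
  have -> : (t * B * ((F / 2) `^ (r - 1) * wE) = K * B)%R.
    have p0' := lt0r_neq0 p0; have w0' := lt0r_neq0 w0.
    rewrite /t; field.
    by apply/andP; split.
  by rewrite mulrA.
- by rewrite gt0_muley ?lte_fin// leey.
- by move: g0; rewrite gt0_muleNy ?lte_fin.
Qed.

Lemma measurable_fun_plane_mul (f : R * R -> R) u E : nonneg_measurable u ->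
  measurable_fun setT f -> measurable_fun E (fun z => (f z * u z.1 z.2)%:E).
Proof.
move=> [mu _] mf; apply: measurable_funTS; apply/measurable_EFinP.
exact: measurable_funM.
Qed.

Lemma A1_linear E u (K wE : R) (f : R * R -> R) : finite_pos E ->
  nonneg_measurable u -> (0 < K)%R -> (0 <= wE)%R ->
  {ae mu2, forall z, E z -> (wE <= K * u z.1 z.2)%R} ->
  measurable_fun setT f -> (forall z, 0 <= f z)%R ->
  wE%:E * avg E (fun z => (f z)%:E) <= K%:E * avg E (fun z => (f z * u z.1 z.2)%:E).
Proof.
move=> pE gu K0 w0 uE mf f0; have [_ u0] := gu.
have mfE : measurable_fun E (fun z => (f z)%:E).
  by apply: measurable_funTS; exact/measurable_EFinP.
have mfu := @measurable_fun_plane_mul f u E gu mf.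
have fu0 z : 0 <= (f z * u z.1 z.2)%:E by rewrite lee_fin mulr_ge0.
rewrite -avgZl//; [|by move=> z _; rewrite lee_fin].
rewrite -avgZl//; [|by rewrite lee_fin ltW].
apply: le_avg_ae => //.
- exact: measurable_funeM.
- exact: measurable_funeM.
- by move=> z _; rewrite -EFinM lee_fin mulr_ge0.
- by move=> z _; rewrite mule_ge0// lee_fin ltW.
- apply: ae_imply uE => z uz /uz {}uz; rewrite -!EFinM lee_fin.
  by rewrite mulrC mulrCA ler_wpM2l.
Qed.

Lemma RHinf_linear E u (K : R) (f : R * R -> R) : finite_pos E ->
  nonneg_measurable u -> (0 <= K)%R ->
  {ae mu2, forall z, E z -> (u z.1 z.2 <= K)%R} ->
  measurable_fun setT f -> (forall z, 0 <= f z)%R ->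
  avg E (fun z => (f z * u z.1 z.2)%:E) <= K%:E * avg E (fun z => (f z)%:E).
Proof.
move=> pE gu K0 uE mf f0; have [_ u0] := gu.
have mfE : measurable_fun E (fun z => (f z)%:E).
  by apply: measurable_funTS; exact/measurable_EFinP.
have mfu := @measurable_fun_plane_mul f u E gu mf.
rewrite -avgZl//; [|by move=> z _; rewrite lee_fin].
apply: le_avg_ae => //.
- exact: measurable_funeM.
- by move=> z _; rewrite lee_fin mulr_ge0.
- by move=> z _; rewrite -EFinM lee_fin mulr_ge0.
- apply: ae_imply uE => z uz /uz {}uz; rewrite -!EFinM lee_fin.
  by rewrite mulrC ler_wpM2r.
Qed.

(** Average [young_RH] for [u / B] and [m / G] and multiply by [B * G ^ (p - 1)]. Both normalised
    powers have average at most 1, whence the factor 2. *)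
Lemma RHp_linear E u (p B G : R) (m : R * R -> R) : finite_pos E ->
  nonneg_measurable u -> (1 < p)%R -> (0 < B)%R -> (0 < G)%R ->
  avg E (fun z => (u z.1 z.2 `^ p)%:E) <= (B `^ p)%:E ->
  measurable_fun setT m -> (forall z, 0 <= m z)%R ->
  avg E (fun z => (m z `^ p)%:E) = (G `^ p)%:E ->
  avg E (fun z => (m z `^ (p - 1) * u z.1 z.2)%:E) <= (2 * B * G `^ (p - 1))%:E.
Proof.
move=> pE gu p1 B0 G0 uB mm m0 mG; have [mu u0] := gu.
have mpow (g : R * R -> R) q : measurable_fun setT g -> measurable_fun E (fun z => (g z `^ q)%:E).
  move=> mg; apply: measurable_funTS; apply/measurable_EFinP.
  exact: (measurableT_comp (measurable_powR _)).
have mlhs : measurable_fun E (fun z => (m z `^ (p - 1) * u z.1 z.2)%:E).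
  by apply: measurable_fun_plane_mul => //; exact: (measurableT_comp (measurable_powR _)).
have Bp : (0 < B `^ p)%R by rewrite powR_gt0.
have Gp : (0 < G `^ p)%R by rewrite powR_gt0.
have Gp1 : (0 < G `^ (p - 1))%R by rewrite powR_gt0.
pose a := (B * G `^ (p - 1) / B `^ p)%R.
pose b := (B * G `^ (p - 1) / G `^ p)%R.
have a0 : (0 <= a)%R by rewrite ltW// divr_gt0// mulr_gt0.
have b0 : (0 <= b)%R by rewrite ltW// divr_gt0// mulr_gt0.
apply: (@le_trans _ _ (a%:E * avg E (fun z => (u z.1 z.2 `^ p)%:E) +
    b%:E * avg E (fun z => (m z `^ p)%:E))); last first.
  rewrite mG; apply: (@le_trans _ _ (a%:E * (B `^ p)%:E + b%:E * (G `^ p)%:E)).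
    by rewrite leeD2r// lee_wpmul2l// lee_fin.
  rewrite -!EFinM -EFinD lee_fin /a /b !divfK ?gt_eqF//; lra.
rewrite -avgZl//; [|exact: mpow|by move=> z _; rewrite lee_fin powR_ge0].
rewrite -avgZl//; [|exact: mpow|by move=> z _; rewrite lee_fin powR_ge0].
rewrite -avgD//.
- apply: le_avg; first exact: pE.
  + by [].
  + by apply: emeasurable_funD; apply: measurable_funeM; exact: mpow.
  + by move=> z _; rewrite lee_fin mulr_ge0// powR_ge0.
  + move=> z _; rewrite -!EFinM -EFinD lee_fin.
    have := @young_RH _ p (u z.1 z.2 / B)%R (m z / G)%R p1
       (divr_ge0 (u0 _ _) (ltW B0)) (divr_ge0 (m0 _) (ltW G0)).
    rewrite !powRM ?invr_ge0 ?(ltW B0) ?(ltW G0)// !powR_invl ?(ltW B0) ?(ltW G0)// => h.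
    have hh : (0 <= B * G `^ (p - 1))%R by rewrite ltW// mulr_gt0.
    have := ler_wpM2l hh h; rewrite /a /b.
    have p0 := lt0r_neq0 Bp; have p2 := lt0r_neq0 Gp; have p3 := lt0r_neq0 Gp1.
    have p4 := lt0r_neq0 B0.
    have -> : (B * G `^ (p - 1) * (m z `^ (p - 1) / G `^ (p - 1) * (u z.1 z.2 / B)) =
      m z `^ (p - 1) * u z.1 z.2)%R by field; apply/andP; split.
    move=> {}h; apply: (le_trans h); lra.
- by apply: measurable_funeM; exact: mpow.
- by apply: measurable_funeM; exact: mpow.
- by move=> z _; rewrite -EFinM lee_fin mulr_ge0// powR_ge0.
- by move=> z _; rewrite -EFinM lee_fin mulr_ge0// powR_ge0.
Qed.

(** This is Jensen's inequality for [exp (h + log u)]: its average should be at least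
    [exp (H + avg (log u))], while [avg (log u) >= ln wE - M]. The averaged inequality [tangent_exp]
    proves it also when [u] vanishes somewhere. *)
Lemma Ainf_linear E u (M wE H : R) (h : R * R -> R) : finite_pos E ->
  nonneg_measurable u -> (0 < wE)%R -> avg E (plane u) = wE%:E ->
  avg E (fun z => log_plus wE (plane u z)) <= M%:E ->
  measurable_fun setT h -> (forall z, 0 <= h z)%R ->
  avg E (fun z => (h z)%:E) = H%:E ->
  (expR H * wE)%:E <= (expR M)%:E * avg E (fun z => (expR (h z) * u z.1 z.2)%:E).
Proof.
move=> pE gu w0 uE lE mh h0 hH; have [mu u0] := gu.
have mexp : measurable_fun setT (fun z => expR (h z)).
  by apply: (measurableT_comp (@measurable_expR R)).
have mX : measurable_fun E (fun z => (expR (h z) * u z.1 z.2)%:E).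
  exact: measurable_fun_plane_mul.
have X0 z : 0 <= (expR (h z) * u z.1 z.2)%:E by rewrite lee_fin mulr_ge0// expR_ge0.
set X := avg E (fun z => (expR (h z) * u z.1 z.2)%:E).
have [HM|MH] := leP H M.
  have : wE%:E <= X.
    rewrite -uE; apply: le_avg => //; first exact: measurable_plane.
      by move=> z _; exact: plane_ge0.
    move=> z _; rewrite lee_fin ler_peMl// -expR0 ler_expR//.
  rewrite EFinM => wX; apply: (@le_trans _ _ ((expR M)%:E * wE%:E)).
    by rewrite lee_wpmul2r ?lee_fin ?ler_expR// ltW.
  by rewrite lee_wpmul2l// lee_fin expR_ge0.
(* Now [M + c = H], so the averaged tangent inequality reads [k * (1 + H) <= X + k * H] and yields
   [k <= X]. The case [H > M] provides the [0 <= c] that [tangent_exp] requires. *)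
pose c := (H - M)%R.
have c0 : (0 <= c)%R by rewrite subr_ge0 ltW.
pose k := (wE * expR c)%R.
have k0 : (0 < k)%R by rewrite mulr_gt0// expR_gt0.
have mh1 : measurable_fun E (fun z => (1 + h z)%:E).
  by apply: measurable_funTS; apply/measurable_EFinP; apply: measurable_funD.
have ml : measurable_fun E (fun z => log_plus wE (plane u z)).
  by apply: (measurableT_comp (@measurable_log_plus R wE)); exact: measurable_plane.
have mlc : measurable_fun E (fun z => log_plus wE (plane u z) + c%:E).
  by apply: emeasurable_funD => //; exact: measurable_cst.
have lc0 z : 0 <= log_plus wE (plane u z) + c%:E.
  by rewrite adde_ge0 ?lee_fin// log_plus_ge0.
have key : k%:E * (1 + H)%:E <= X + k%:E * (M + c)%:E.
  have -> : (1 + H)%:E = avg E (fun z => (1 + h z)%:E).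
    rewrite EFinD -hH -(avg_cst 1%:E pE) -avgD//.
      by apply: measurable_funTS; exact/measurable_EFinP.
    by move=> z _; rewrite lee_fin.
  have : avg E (fun z => log_plus wE (plane u z) + c%:E) <= (M + c)%:E.
    rewrite avgD//; [|by move=> z _; exact: log_plus_ge0].
    by rewrite avg_cst// [(M + c)%:E]EFinD leeD2r.
  move=> /(lee_wpmul2l (_ : 0 <= k%:E)) h1.
  apply: (le_trans _ (leeD2l _ (h1 _))); last by rewrite lee_fin ltW.
  rewrite -avgZl//; [|by move=> z _; rewrite lee_fin addr_ge0|by rewrite lee_fin ltW].
  rewrite -avgZl//; [|by rewrite lee_fin ltW].
  rewrite /X -avgD//; [|exact: measurable_funeM|by move=> z _; rewrite mule_ge0// lee_fin ltW].
  apply: le_avg; first exact: pE.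
  - exact: measurable_funeM.
  - by apply: emeasurable_funD => //; exact: measurable_funeM.
  - by move=> z _; rewrite mule_ge0// lee_fin ?addr_ge0// ltW.
  - by move=> z _; exact: tangent_exp.
have XX0 : 0 <= X by exact: avg_ge0.
move: key XX0; case: X => [x| |] key XX0; last (by []); last first.
  by rewrite gt0_muley ?lte_fin ?expR_gt0// leey.
move: key; rewrite -!EFinM -EFinD !lee_fin => key.
have kx : (k <= x)%R by rewrite /c in key; lra.
have -> : (expR H = expR M * expR c)%R by rewrite -expRD /c; congr expR; lra.
by rewrite -mulrA [X in (_ * X <= _)%R]mulrC ler_wpM2l// expR_ge0.
Qed.

End Linear.

(** * Consequences of the bounds on one rectangle *)

Section SingleRect.
Variable R : realType.
Local Notation mu2 := (@mu2 R).
Implicit Types (E Q : set (R * R)) (u : R -> R -> R).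
Local Open Scope ereal_scope.
Local Notation lift u := (fun x y => (u x y)%:E).

Lemma Ap_rect_dual_bound E u (r V wE : R) : (1 < r)%R -> (0 < V)%R ->
  (0 < wE)%R -> avg E (plane u) = wE%:E -> Ap_rect r%:E (lift u) E <= V%:E ->
  avg E (fun z => poweR (plane u z)^-1 (r - 1)^-1) <= ((V / wE) `^ (r - 1)^-1)%:E.
Proof.
move=> r1 V0 w0 uE; rewrite /Ap_rect gt_eqF// -/(plane u) uE => h.
have r10 : (0 < r - 1)%R by lra.
have S0 : 0 <= avg E (fun z => poweR (plane u z)^-1 (r - 1)^-1).
  by apply: avg_ge0 => z _; exact: poweR_ge0.
move: h S0; case: (avg E (fun z => poweR (plane u z)^-1 (r - 1)^-1)) => [S| |]//.
- rewrite poweR_EFin -EFinM !lee_fin => h S0.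
  rewrite -[leLHS](powRK S0 r10); apply: ge0_ler_powR.
  + by rewrite invr_ge0 ltW.
  + by rewrite nnegrE powR_ge0.
  + by rewrite nnegrE divr_ge0// ltW.
  + by rewrite ler_pdivlMr// mulrC.
- by rewrite poweRyr ?gt_eqF// gt0_muley ?lte_fin// leye_eq.
Qed.

(** An essential infimum is a supremum of almost everywhere lower bounds, perhaps not known to be
    attained. The factor 2 produces a number strictly below it, hence below one of those bounds. *)
Lemma A1_rect_ae E u (V wE : R) : nonneg_measurable u -> (0 < V)%R ->
  (0 < wE)%R -> avg E (plane u) = wE%:E -> Ap_rect 1%:E (lift u) E <= V%:E ->
  {ae mu2, forall z, E z -> (wE <= 2 * V * u z.1 z.2)%R}.
Proof.
move=> gu V0 w0 uE; rewrite /Ap_rect eqxx -/(plane u) uE => h.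
have inf0 : 0 <= essinf_on E (plane u).
  by apply: ereal_sup_ubound; apply: aeW => z _; exact: plane_ge0.
have : (wE / (2 * V))%:E < essinf_on E (plane u).
  move: h inf0; case: (essinf_on E (plane u)) => [m| |]//; last by rewrite ltry.
  rewrite lte_fin inver lee_fin; case: ifPn => [_|m0].
    by rewrite gt0_muley ?lte_fin// leye_eq.
  rewrite -EFinM lee_fin => h m1.
  have {}m0 : (0 < m)%R by rewrite lt_neqAle eq_sym m0 m1.
  move: h; rewrite ler_pdivrMr// ltr_pdivrMr ?mulr_gt0// => h.
  by have : (0 < m * V)%R by [exact: mulr_gt0]; lra.
move=> /ereal_sup_gt[m mE wm]; apply: ae_imply mE => z + Ez => /(_ Ez) mz.
have := lt_le_trans wm mz; rewrite lte_fin ltr_pdivrMr ?mulr_gt0//.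
by rewrite mulrC => /ltW.
Qed.

Lemma RHp_rect_power_bound E u (p V wE : R) : (1 < p)%R -> (0 < V)%R ->
  (0 < wE)%R -> avg E (plane u) = wE%:E -> RHp_rect p%:E (lift u) E <= V%:E ->
  avg E (fun z => (u z.1 z.2 `^ p)%:E) <= ((V * wE) `^ p)%:E.
Proof.
move=> p1 V0 w0 uE; rewrite /RHp_rect -/(plane u) uE => h.
have p0 : (0 < p)%R by lra.
have S0 : 0 <= avg E (fun z => (u z.1 z.2 `^ p)%:E).
  by apply: avg_ge0 => z _; rewrite lee_fin powR_ge0.
move: h S0; rewrite inver gt_eqF//.
rewrite -/(avg E (fun z => (u z.1 z.2 `^ p)%:E)).
case: (avg E (fun z => (u z.1 z.2 `^ p)%:E)) => [S| |]//.
- rewrite poweR_EFin -EFinM !lee_fin ler_pdivrMr// => h S0.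
  rewrite -[leLHS](powRVK S0 p0); apply: ge0_ler_powR.
  + exact: ltW.
  + by rewrite nnegrE powR_ge0.
  + by rewrite nnegrE mulr_ge0// ltW.
  + by [].
- by rewrite poweRyr ?invr_eq0 ?gt_eqF// gt0_mulye ?lte_fin ?invr_gt0// leye_eq.
Qed.

(** The factor 2 again makes room for a strict inequality, now above the essential supremum. *)
Lemma RHinf_rect_ae E u (V wE : R) : (1 <= V)%R ->
  (0 < wE)%R -> avg E (plane u) = wE%:E -> RHp_rect +oo (lift u) E <= V%:E ->
  {ae mu2, forall z, E z -> (u z.1 z.2 <= 2 * V * wE)%R}.
Proof.
move=> V1 w0 uE; rewrite /RHp_rect -/(plane u) uE inver gt_eqF// lee_pdivrMr// => h.
have : esssup_on E (plane u) < (2 * V * wE)%:E.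
  apply: (le_lt_trans h); rewrite -EFinM lte_fin ltr_pM2r//; lra.
move=> /ereal_inf_lt[m mE wm]; apply: ae_imply mE => z + Ez => /(_ Ez) mz.
by have := le_lt_trans mz wm; rewrite lte_fin => /ltW.
Qed.

(** The integral of a signed function is a difference of integrals; a finite negative part rules out
    [+oo - +oo] when the normalising factor is distributed. *)
Lemma avg_posneg E (f : R * R -> \bar R) : finite_pos E ->
  avg E (fun z => maxe (- f z) 0) < +oo ->
  avg E f = avg E (fun z => maxe (f z) 0) - avg E (fun z => maxe (- f z) 0).
Proof.
move=> pE fn; rewrite /avg integralE muleBl//.
  by congr (_ * _ - _ * _); apply: eq_integral => z _; rewrite ?funeposE ?funenegE.
apply: fin_num_adde_defl; rewrite fin_numN.
have i0 : 0 <= \int[mu2]_(z in E) maxe (- f z) 0.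
  by apply: integral_ge0 => z _; rewrite le_max lexx orbT.
have -> : \int[mu2]_(z in E) f^\- z = \int[mu2]_(z in E) maxe (- f z) 0.
  by apply: eq_integral => z _; rewrite funenegE.
move: fn; have [_ [m m0 Em]] := pE; rewrite /avg Em/=.
move: i0; case: (\int[mu2]_(z in E) maxe (- f z) 0) => [x| |]//.
by rewrite gt0_mulye ?lte_fin ?invr_gt0.
Qed.

Lemma measurable_log_inv E (W : R * R -> \bar R) : measurable E ->
  measurable_fun E W -> (forall z, E z -> 0 <= W z) ->
  measurable_fun E (fun z => lne (W z)^-1).
Proof.
move=> mE mW W0; apply: (measurableT_comp (@measurable_lne R)).
exact: measurable_inve_comp.
Qed.

Lemma avg_log_inv_neg E (W : R * R -> \bar R) : finite_pos E ->
  measurable_fun E W -> (forall z, E z -> 0 <= W z) ->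
  avg E (fun z => maxe (- lne (W z)^-1) 0) <= avg E W.
Proof.
move=> pE mW W0; have [mE _] := pE; apply: le_avg => //.
- apply: measurable_maxe => //; apply: measurableT_comp => //.
  exact: measurable_log_inv.
- by move=> z _; rewrite le_max lexx orbT.
- by move=> z /W0; exact: neg_lne_inv_le_id.
Qed.

(** Average [log_plus_defect] with [c = wE]. The [A_oo] bound controls [avg (log (wE / u))] by
    [ln V], and [avg (u / wE) = 1] is the additional 1. *)
Lemma Ainf_rect_log_plus E u (V wE : R) : finite_pos E -> nonneg_measurable u ->
  (0 < V)%R -> (0 < wE)%R -> avg E (plane u) = wE%:E ->
  Ap_rect +oo (lift u) E <= V%:E ->
  avg E (fun z => log_plus wE (plane u z)) <= (ln V + 1)%:E.
Proof.
move=> pE gu V0 w0 uE; have [mE _] := pE; have [_ u0] := gu.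
rewrite /Ap_rect -/(plane u) uE; pose L z := lne (plane u z)^-1; rewrite -/L => h.
have mu := @measurable_plane _ u E gu.
have mL : measurable_fun E L.
  by apply: measurable_log_inv => // z _; exact: plane_ge0.
have mLp : measurable_fun E (fun z => maxe (L z) 0) by exact: measurable_maxe.
have mLn : measurable_fun E (fun z => maxe (- L z) 0).
  by apply: measurable_maxe => //; exact: measurableT_comp.
have p0 (x : \bar R) : 0 <= maxe x 0 by rewrite le_max lexx orbT.
have Anw : avg E (fun z => maxe (- L z) 0) <= avg E (plane u) :=
  avg_log_inv_neg pE mu (fun z _ => plane_ge0 z gu).
have An0 : 0 <= avg E (fun z => maxe (- L z) 0) by exact: avg_ge0.
rewrite (avg_posneg pE) in h; last by rewrite (le_lt_trans Anw)// uE ltry.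
have ml : measurable_fun E (fun z => log_plus wE (plane u z)).
  by apply: (measurableT_comp (@measurable_log_plus R wE)).
have l0 z : 0 <= log_plus wE (plane u z) by exact: log_plus_ge0.
pose c1 := Num.max 0%R (ln wE); pose c2 := Num.max 0%R (- ln wE)%R.
have c10 : 0 <= c1%:E by rewrite lee_fin le_max lexx.
have c20 : 0 <= c2%:E by rewrite lee_fin le_max lexx.
have muw : measurable_fun E (fun z => (wE^-1)%:E * plane u z) by exact: measurable_funeM.
have uw0 z : 0 <= (wE^-1)%:E * plane u z.
  by rewrite mule_ge0 ?plane_ge0// lee_fin invr_ge0 ltW.
have key : avg E (fun z => log_plus wE (plane u z)) + avg E (fun z => maxe (- L z) 0) + c2%:E
    <= avg E (fun z => maxe (L z) 0) + 1%:E + c1%:E.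
  have <- : avg E (fun z => (wE^-1)%:E * plane u z) = 1%:E.
    rewrite avgZl//; [|by move=> z _; exact: plane_ge0|by rewrite lee_fin invr_ge0 ltW].
    by rewrite uE -EFinM mulVf// gt_eqF.
  rewrite -(avg_cst c1%:E pE) -(avg_cst c2%:E pE).
  rewrite -!avgD//; try (by move=> z _; rewrite adde_ge0); try exact: emeasurable_funD.
  apply: le_avg => //.
  - by do 2 apply: emeasurable_funD => //.
  - by do 2 apply: emeasurable_funD => //.
  - by move=> z _; rewrite !adde_ge0.
  - move=> z _; have := log_plus_defect w0 (u0 z.1 z.2).
    by rewrite -[(wE^-1)%:E * _]EFinM [(wE^-1 * _)%R]mulrC.
have x0 : 0 <= avg E (fun z => maxe (L z) 0) by exact: avg_ge0.
have y0 : 0 <= avg E (fun z => log_plus wE (plane u z)) by exact: avg_ge0.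
rewrite uE in Anw.
move: (avg E (fun z => maxe (- L z) 0)) (avg E (fun z => maxe (L z) 0))
  (avg E (fun z => log_plus wE (plane u z))) Anw An0 x0 y0 h key.
(* The negative part has average [b] at most [wE], hence finite; an infinite positive part would
   contradict the [A_oo] bound. *)
case=> [b| |]//; case=> [a| |]//; last first.
  by move=> y _ _ _ _; rewrite addye//= gt0_muley ?lte_fin// leye_eq.
case=> [y| |]//.
move=> _ _ _ _; rewrite -EFinB /= -EFinM lee_fin => h.
rewrite -!EFinD !lee_fin => key.
have : (a - b <= ln V - ln wE)%R.
  have -> : (ln V - ln wE = ln (V / wE))%R by rewrite ln_div ?posrE.
  rewrite -ler_expR lnK ?posrE ?divr_gt0// ler_pdivlMr// mulrC//.
have : (c1 - c2 = ln wE)%R by rewrite /c1 /c2 !maxEle; do 2 case: ifPn; rewrite -?ltNge => *; lra.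
by lra.
Qed.

(** The way back from [log^+] to the [A_oo] quantity, by averaging [neg_lne_inv_le]. It is stated
    for extended real values because the averaged weight may be [+oo] at some points. *)
Lemma Ainf_of_log_plus E (W : R * R -> \bar R) (M wE : R) : finite_pos E ->
  measurable_fun E W -> (forall z, E z -> 0 <= W z) ->
  (0 < wE)%R -> avg E W = wE%:E ->
  avg E (fun z => log_plus wE (W z)) <= M%:E ->
  avg E W * expeR (avg E (fun z => lne (W z)^-1)) <= (expR M)%:E.
Proof.
move=> pE mW W0 w0 WE lM; have [mE _] := pE.
pose L z := lne (W z)^-1; rewrite -/L.
have mL : measurable_fun E L by exact: measurable_log_inv.
have mLp : measurable_fun E (fun z => maxe (L z) 0) by exact: measurable_maxe.
have mLn : measurable_fun E (fun z => maxe (- L z) 0).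
  by apply: measurable_maxe => //; exact: measurableT_comp.
have p0 (x : \bar R) : 0 <= maxe x 0 by rewrite le_max lexx orbT.
have Anw : avg E (fun z => maxe (- L z) 0) <= avg E W := avg_log_inv_neg pE mW W0.
have An0 : 0 <= avg E (fun z => maxe (- L z) 0) by exact: avg_ge0.
rewrite (@avg_posneg E L pE); last by rewrite (le_lt_trans Anw)// WE ltry.
have ml : measurable_fun E (fun z => log_plus wE (W z)).
  by apply: (measurableT_comp (@measurable_log_plus R wE)).
have l0 z : 0 <= log_plus wE (W z) by exact: log_plus_ge0.
pose c1 := Num.max 0%R (ln wE); pose c2 := Num.max 0%R (- ln wE)%R.
have c10 : 0 <= c1%:E by rewrite lee_fin le_max lexx.
have c20 : 0 <= c2%:E by rewrite lee_fin le_max lexx.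
have key : avg E (fun z => maxe (L z) 0) + c1%:E <=
    avg E (fun z => log_plus wE (W z)) + avg E (fun z => maxe (- L z) 0) + c2%:E.
  rewrite -(avg_cst c1%:E pE) -(avg_cst c2%:E pE).
  rewrite -!avgD//; try (by move=> z _; rewrite adde_ge0); try exact: emeasurable_funD.
  apply: le_avg => //.
  - by apply: emeasurable_funD => //.
  - by do 2 apply: emeasurable_funD => //.
  - by move=> z _; rewrite !adde_ge0.
  - by move=> z /W0; exact: neg_lne_inv_le.
have x0 : 0 <= avg E (fun z => maxe (L z) 0) by exact: avg_ge0.
have y0 : 0 <= avg E (fun z => log_plus wE (W z)) by exact: avg_ge0.
rewrite WE in Anw *.
move: (avg E (fun z => maxe (- L z) 0)) (avg E (fun z => maxe (L z) 0))
  (avg E (fun z => log_plus wE (W z))) Anw An0 x0 y0 lM key.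
case=> [b| |]//; case=> [a| |]//; case=> [y| |]//.
move=> _ _ _ _; rewrite lee_fin => yM.
rewrite -!EFinD lee_fin => key; rewrite /= -EFinM lee_fin.
have -> : (wE = expR (ln wE))%R by rewrite lnK ?posrE.
rewrite -expRD ler_expR.
have : (c1 - c2 = ln wE)%R by rewrite /c1 /c2 !maxEle; do 2 case: ifPn; rewrite -?ltNge => *; lra.
by lra.
Qed.

End SingleRect.

(** * From dyadic to arbitrary rectangles *)

Section DyadicToRect.
Variable R : realType.
Local Notation mu2 := (@mu2 R).
Implicit Types (E Q : set (R * R)) (u : R -> R -> R).
Local Open Scope ereal_scope.
Local Notation lift u := (fun x y => (u x y)%:E).

(** [wD] is positive because [0 < wQ <= 4 C^2 wD], so the estimates on one rectangle, which divide
    by the average, apply to [D]. *)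
Lemma comparable_weights Q D u (C wQ : R) : comparable_rect Q D -> (1 <= C)%R ->
  doubling C (lift u) -> nonneg_measurable u -> avg Q (plane u) = wQ%:E -> (0 < wQ)%R ->
  exists2 wD : R, (0 < wD)%R & [/\ avg D (plane u) = wD%:E,
    (wQ <= 4 * C ^+ 2 * wD)%R & (wD <= C ^+ 3 * wQ)%R].
Proof.
move=> [_ _ _ /(_ C u) cmp] C1 du gu uQ w0; have [h1 h2] := cmp C1 du gu.
rewrite uQ -EFinM in h1 h2.
have u0 : 0 <= avg D (plane u) by apply: avg_ge0 => z _; exact: plane_ge0.
move: u0 h1 h2; case: (avg D (plane u)) => [wD| |]//.
rewrite -EFinM !lee_fin => u0 h1 h2; exists wD => //.
rewrite lt_neqAle u0 andbT; apply/eqP => wD0.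
by move: h1; rewrite -wD0 mulr0 leNgt w0.
Qed.

Section OneRect.
Variables (u : R -> R -> R) (C V wQ a1 l1 a2 l2 : R).
Hypotheses (C1 : (1 <= C)%R) (V1 : (1 <= V)%R) (du : doubling C (lift u)).
Hypotheses (gu : nonneg_measurable u) (lp : rect_param l1 l2).
Let Q := rect a1 l1 a2 l2.
Hypotheses (uQ : avg Q (plane u) = wQ%:E) (w0 : (0 < wQ)%R).

Let V0 : (0 < V)%R. Proof. exact: lt_le_trans ltr01 V1. Qed.
Let C0 : (0 < C)%R. Proof. exact: lt_le_trans ltr01 C1. Qed.
Let C20 : (0 < C ^+ 2)%R. Proof. exact: exprn_gt0. Qed.
Let C30 : (0 < C ^+ 3)%R. Proof. exact: exprn_gt0. Qed.

(** On each dyadic rectangle [V / wD <= 4 C^2 V / wQ]. The 16 of the cover is written as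
    [16 ^ (r - 1)] under the exponent, so that the bound has the shape [(K / wQ) ^ (1 / (r - 1))]
    expected by [Ap_linear]. *)
Lemma Apd_dual_bound (r : R) : (1 < r)%R ->
  (forall D, dyad_rects D -> Ap_rect r%:E (lift u) D <= V%:E) ->
  avg Q (fun z => poweR (plane u z)^-1 (r - 1)^-1) <=
  ((16 `^ (r - 1) * (4 * C ^+ 2 * V) / wQ) `^ (r - 1)^-1)%:E.
Proof.
move=> r1 uV; have [D [QD cD]] := rect_cover a1 a2 lp.
have r10 : (0 < r - 1)%R by lra.
have -> : ((16 `^ (r - 1) * (4 * C ^+ 2 * V) / wQ) `^ (r - 1)^-1 =
    16 * (4 * C ^+ 2 * V / wQ) `^ (r - 1)^-1)%R.
  rewrite -mulrA powRM ?powR_ge0// ?powRK//.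
  by rewrite ltW// divr_gt0// !mulr_gt0.
rewrite EFinM; apply: (le_avg_cover lp QD cD).
- apply: (measurableT_comp (measurable_poweR _)).
  by apply: measurable_inve_comp => //; [exact: measurable_plane|move=> z _; exact: plane_ge0].
- by move=> z; exact: poweR_ge0.
- by rewrite lee_fin powR_ge0.
move=> i j; have [wD wD0 [uD wQD _]] := comparable_weights (cD i j) C1 du gu uQ w0.
have [dD pD _ _] := cD i j.
apply: (le_trans (Ap_rect_dual_bound r1 V0 wD0 uD _)).
  exact: uV.
rewrite lee_fin; apply: ge0_ler_powR.
- by rewrite invr_ge0 ltW.
- by rewrite nnegrE divr_ge0// ltW.
- by rewrite nnegrE ltW// divr_gt0// !mulr_gt0.
- rewrite ler_pdivrMr// mulrAC ler_pdivlMr// mulrAC [leRHS]mulrC.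
  by rewrite ler_wpM2l// ltW.
Qed.

Lemma ae_cover (D : bool -> bool -> set (R * R)) (P : R * R -> Prop) :
  Q `<=` (D true true `|` D true false) `|` (D false true `|` D false false) ->
  (forall i j, {ae mu2, forall z, D i j z -> P z}) -> {ae mu2, forall z, Q z -> P z}.
Proof.
move=> QD DP.
apply: ae_imply (ae_conj (ae_conj (DP true true) (DP true false))
  (ae_conj (DP false true) (DP false false))) => z [[h1 h2] [h3 h4]] /QD.
by move=> [[]|[]].
Qed.

(** The 8 is the 4 from comparing [wQ] with [wD] times the 2 lost in [A1_rect_ae]. *)
Lemma A1d_ae : (forall D, dyad_rects D -> Ap_rect 1%:E (lift u) D <= V%:E) ->
  {ae mu2, forall z, Q z -> (wQ <= 8 * C ^+ 2 * V * u z.1 z.2)%R}.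
Proof.
move=> uV; have [D [QD cD]] := rect_cover a1 a2 lp.
apply: (ae_cover QD) => i j.
have [wD wD0 [uD wQD _]] := comparable_weights (cD i j) C1 du gu uQ w0.
have [dD pD _ _] := cD i j.
have h : Ap_rect 1%:E (lift u) (D i j) <= V%:E.
  exact: uV.
apply: ae_imply (A1_rect_ae gu V0 wD0 uD h) => z hz /hz {}hz.
have : (4 * C ^+ 2 * wD <= 4 * C ^+ 2 * (2 * V * u z.1 z.2))%R.
  by rewrite ler_wpM2l// mulr_ge0// ltW.
by move=> /(le_trans wQD) /le_trans; apply; lra.
Qed.

Lemma RHinfd_ae : (forall D, dyad_rects D -> RHp_rect +oo (lift u) D <= V%:E) ->
  {ae mu2, forall z, Q z -> (u z.1 z.2 <= 2 * V * C ^+ 3 * wQ)%R}.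
Proof.
move=> uV; have [D [QD cD]] := rect_cover a1 a2 lp.
apply: (ae_cover QD) => i j.
have [wD wD0 [uD _ wDQ]] := comparable_weights (cD i j) C1 du gu uQ w0.
have [dD pD _ _] := cD i j.
have h : RHp_rect +oo (lift u) (D i j) <= V%:E.
  exact: uV.
apply: ae_imply (RHinf_rect_ae V1 wD0 uD h) => z hz /hz /le_trans; apply.
rewrite -[leRHS]mulrA; apply: ler_wpM2l => //.
by apply: mulr_ge0 => //; exact: ltW.
Qed.

Lemma RHpd_power_bound (p : R) : (1 < p)%R ->
  (forall D, dyad_rects D -> RHp_rect p%:E (lift u) D <= V%:E) ->
  avg Q (fun z => (u z.1 z.2 `^ p)%:E) <= ((16 * V * C ^+ 3 * wQ) `^ p)%:E.
Proof.
move=> p1 uV; have [D [QD cD]] := rect_cover a1 a2 lp.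
have B0 : (0 < V * C ^+ 3 * wQ)%R by rewrite !mulr_gt0.
(* [16 <= 16 ^ p] brings the 16 of the cover inside the power. *)
apply: (@le_trans _ _ (16%:E * ((V * C ^+ 3 * wQ) `^ p)%:E)); last first.
  have -> : (16 * V * C ^+ 3 * wQ = 16 * (V * C ^+ 3 * wQ))%R by rewrite !mulrA.
  rewrite -EFinM lee_fin [leRHS]powRM//; last exact: ltW.
  rewrite ler_wpM2r ?powR_ge0// -[leLHS]powRr1//; apply: ler_powR; lra.
apply: (le_avg_cover lp QD cD).
- apply/measurable_EFinP; apply: (measurableT_comp (measurable_powR _)).
  by case: gu.
- by move=> z; rewrite lee_fin powR_ge0.
- by rewrite lee_fin powR_ge0.
move=> i j; have [wD wD0 [uD _ wDQ]] := comparable_weights (cD i j) C1 du gu uQ w0.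
have [dD pD _ _] := cD i j.
apply: (le_trans (RHp_rect_power_bound p1 V0 wD0 uD _)).
  exact: uV.
rewrite lee_fin; apply: ge0_ler_powR.
- by lra.
- by rewrite nnegrE mulr_ge0// ltW.
- by rewrite nnegrE ltW.
- by rewrite -mulrA ler_wpM2l// ltW.
Qed.

(** Passing from [wQ] to [wD] inside the logarithm costs [ln (4 C^2)]; then [Ainf_rect_log_plus]
    applies on each dyadic rectangle of the cover. *)
Lemma Ainfd_log_plus : (forall D, dyad_rects D -> Ap_rect +oo (lift u) D <= V%:E) ->
  avg Q (fun z => log_plus wQ (plane u z)) <= (16 * (ln (4 * C ^+ 2) + (ln V + 1)))%:E.
Proof.
move=> uV; have [D [QD cD]] := rect_cover a1 a2 lp.
have k1 : (1 <= 4 * C ^+ 2)%R.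
  have : (1 <= C ^+ 2)%R by rewrite exprn_ege1.
  by lra.
have lk : (0 <= ln (4 * C ^+ 2))%R by rewrite ln_ge0.
have lV : (0 <= ln V)%R by rewrite ln_ge0.
rewrite EFinM; apply: (le_avg_cover lp QD cD).
- apply: (measurableT_comp (@measurable_log_plus R wQ)); exact: measurable_plane.
- by move=> z; exact: log_plus_ge0.
- by rewrite lee_fin; lra.
move=> i j; have [wD wD0 [uD wQD _]] := comparable_weights (cD i j) C1 du gu uQ w0.
have [dD pD _ _] := cD i j; have [_ u0] := gu.
have ml c : measurable_fun (D i j) (fun z => log_plus c (plane u z)).
  by apply: (measurableT_comp (@measurable_log_plus R c)); exact: measurable_plane.
apply: (@le_trans _ _ (avg (D i j) (fun z => (ln (4 * C ^+ 2))%:E + log_plus wD (plane u z)))).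
  apply: le_avg => //.
  - by apply: emeasurable_funD => //; exact: measurable_cst.
  - by move=> z _; exact: log_plus_ge0.
  - by move=> z _; exact: log_plus_le_mul.
rewrite avgD//; [|by move=> z _; exact: log_plus_ge0].
rewrite avg_cst// EFinD leeD2l//; apply: Ainf_rect_log_plus => //.
exact: uV.
Qed.

End OneRect.

End DyadicToRect.

(** * Averaging over translations *)

Section Transfer.
Variable R : realType.
Local Notation mu2 := (@mu2 R).
Local Open Scope ereal_scope.
Local Notation lift u := (fun x y => (u x y)%:E).

Lemma mu2_sigma_finite : sigma_finite setT mu2.
Proof.
pose I n : set R := `](- n%:R)%R, n%:R%R]%classic.
exists (fun n => I n `*` I n).
  apply/seteqP; split => // -[x y] _; pose n := (Num.truncn (`|x| + `|y|)%R).+1.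
  have xyn : (`|x| + `|y| < n%:R)%R by exact: truncnS_gt.
  have := normr_ge0 x; have := normr_ge0 y; have := ler_norm x; have := ler_norm y.
  have := ler_norm (- x); have := ler_norm (- y); rewrite !normrN => *.
  by exists n => //; split; rewrite /I /= in_itv/=; lra.
move=> n; have mI : measurable (I n) by exact: measurable_itv.
split; first exact: measurableX.
have Ifin : lebesgue_measure (I n) < +oo.
  by rewrite /I lebesgue_measure_itv/=; case: ifP => // _; rewrite -EFinB ltry.
rewrite /Defs.mu2 product_measure1E//; apply: lte_mul_pinfty => //.
by rewrite ge0_fin_numE.
Qed.

Definition sigma_finite_mu2 :
    {sigma_finite_measure set (measurableTypeR R * measurableTypeR R)%type -> \bar R} :=
  HB.pack (@lebesgue_measure R \x @lebesgue_measure R)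
    (Measure_isSigmaFinite.Build _ _ _ (@lebesgue_measure R \x @lebesgue_measure R)
      mu2_sigma_finite).

Definition unit_square : set (R * R) := @unitI R `*` @unitI R.

Lemma measurable_unit_square : measurable unit_square.
Proof. by apply: measurableX; exact: measurable_itv. Qed.

Definition rot (st z : R * R) : R * R := (tfrac (z.1 + st.1)%R, tfrac (z.2 + st.2)%R).

Definition rotN (st z : R * R) : R * R := (tfrac (z.1 - st.1)%R, tfrac (z.2 - st.2)%R).

Lemma rotNK st z : torus z -> rotN st (rot st z) = z.
Proof.
case: z => x y [/=]; rewrite !in_itv/= => x01 y01.
by rewrite /rotN /rot/= !tfracD_tfrac !addrK !tfrac_id.
Qed.

Lemma measurable_rotN st : measurable_fun setT (rotN st).
Proof. exact: (measurable_rotation2 (- st.1) (- st.2)). Qed.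

Definition shifted_rect a1 l1 a2 l2 (st : R * R) : set (R * R) :=
  rect (a1 + st.1)%R l1 (a2 + st.2)%R l2.

Lemma avg_rotation a1 l1 a2 l2 st (F : R * R -> \bar R) : rect_param l1 l2 ->
  measurable_fun setT F -> (forall z, 0 <= F z) ->
  avg (rect a1 l1 a2 l2) (fun z => F (rot st z)) = avg (shifted_rect a1 l1 a2 l2 st) F.
Proof.
move=> lp mF F0; rewrite /avg /shifted_rect !measure_rect//; congr (_ * _).
exact: integral_rect_rotation.
Qed.

(** A test function rotated along with the rectangle keeps its average. The coefficient that it
    contributes to a linear inequality is therefore constant in [(s, t)]. *)
Lemma avg_rotN a1 l1 a2 l2 st (f : R * R -> R) : rect_param l1 l2 ->
  measurable_fun setT f -> (forall z, (0 <= f z)%R) ->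
  avg (shifted_rect a1 l1 a2 l2 st) (fun z => (f (rotN st z))%:E) =
  avg (rect a1 l1 a2 l2) (fun z => (f z)%:E).
Proof.
move=> lp mf f0; rewrite -avg_rotation//.
- by apply: eq_avg => z /rect_sub_torus zT; rewrite rotNK.
- apply/measurable_EFinP; apply: (measurableT_comp mf); exact: measurable_rotN.
- by move=> z; rewrite lee_fin.
Qed.

(** * Weights that agree on the torus *)

Section Congruence.
Variables (w w' : R -> R -> \bar R).
Hypothesis ww' : forall x y, torus (x, y) -> w x y = w' x y.

Let wf_eq z : torus z -> wf w z = wf w' z.
Proof. by case: z => x y /ww'. Qed.

Lemma eq_essinf_on E : E `<=` @torus R -> essinf_on E (wf w) = essinf_on E (wf w').
Proof.
move=> ET; congr ereal_sup; apply/seteqP; split => M; apply: ae_imply => z h Ez.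
  by rewrite -wf_eq; [exact: h|exact: ET].
by rewrite wf_eq; [exact: h|exact: ET].
Qed.

Lemma eq_esssup_on E : E `<=` @torus R -> esssup_on E (wf w) = esssup_on E (wf w').
Proof.
move=> ET; congr ereal_inf; apply/seteqP; split => M; apply: ae_imply => z h Ez.
  by rewrite -wf_eq; [exact: h|exact: ET].
by rewrite wf_eq; [exact: h|exact: ET].
Qed.

Lemma eq_avg_torus (phi : \bar R -> \bar R) E : E `<=` @torus R ->
  avg E (fun z => phi (wf w z)) = avg E (fun z => phi (wf w' z)).
Proof. by move=> ET; apply: eq_avg => z /ET /wf_eq ->. Qed.

Lemma eq_Ap_rect p E : E `<=` @torus R -> Ap_rect p w E = Ap_rect p w' E.
Proof.
move=> ET; case: p => [r| |]//=.
  rewrite (eq_avg_torus id)// eq_essinf_on//.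
  by rewrite (eq_avg_torus (fun x => poweR x^-1 (r - 1)^-1))%R.
by rewrite (eq_avg_torus id)// (eq_avg_torus (fun x => lne x^-1)).
Qed.

Lemma eq_RHp_rect p E : E `<=` @torus R -> RHp_rect p w E = RHp_rect p w' E.
Proof.
move=> ET; case: p => [r| |]//=.
  by rewrite (eq_avg_torus id)// (eq_avg_torus (fun x => poweR x r)).
by rewrite (eq_avg_torus id)// eq_esssup_on.
Qed.

Lemma dyad_rects_sub E : dyad_rects E -> E `<=` @torus R.
Proof.
move=> [k1 [j1 [k2 [j2 [ok1 [ok2 ->]]]]]].
by rewrite /dyad_rect !dyad_tarc//; exact: rect_sub_torus.
Qed.

Lemma eq_doubling C : doubling C w -> doubling C w'.
Proof.
have eqI a1 l1 a2 l2 : \int[mu2]_(z in rect a1 l1 a2 l2) wf w' z =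
    \int[mu2]_(z in rect a1 l1 a2 l2) wf w z.
  by apply: eq_integral => z /[!inE] /rect_sub_torus/wf_eq.
by move=> dw a1 l1 a2 l2 lp; rewrite !eqI; exact: dw.
Qed.

End Congruence.

(** * Periodic extension of the family and Tonelli's theorem *)

Section Family.
Variables (w : R -> R -> R -> R -> R) (C : R).
Hypothesis fam : family_hyp C w.

(** The family is controlled only over the unit square and the torus. Reduction mod 1 in [(x, y)]
    and the value zero off the unit square give a nonnegative function measurable on the whole
    space, as [nonneg_measurable] demands. *)
Definition periodic_ext (q : (R * R) * (R * R)) : R :=
  fine (((fun q => (w q.1.1 q.1.2 q.2.1 q.2.2)%:E) \_ (unit_square `*` @torus R))
    (q.1, (tfrac q.2.1, tfrac q.2.2))).

Definition ext_weight (st : R * R) (x y : R) : R := periodic_ext (st, (x, y)).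

Lemma torus_tfrac (x y : R) : torus (tfrac x, tfrac y).
Proof. by split; rewrite /= in_itv/= tfrac_itv. Qed.

Lemma periodic_extE st z : unit_square st ->
  periodic_ext (st, z) = w st.1 st.2 (tfrac z.1) (tfrac z.2).
Proof.
move=> stI; rewrite /periodic_ext patchE ifT//= in_setX/=; apply/andP; split.
  by rewrite inE.
by rewrite inE; exact: torus_tfrac.
Qed.

Lemma unit_squareP st : unit_square st -> (st.1 \in `[0%R, 1%R]) /\ (st.2 \in `[0%R, 1%R]).
Proof. by case. Qed.

Lemma periodic_ext_ge0 q : (0 <= periodic_ext q)%R.
Proof.
rewrite /periodic_ext patchE; case: ifPn => //; rewrite inE => -[/=] st z.
have [s t] := unit_squareP st.
by have [[+ _] _] := fam.1 _ _ s t => /(_ _ _ z); rewrite lee_fin.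
Qed.

Lemma measurable_periodic_ext : measurable_fun setT periodic_ext.
Proof.
apply: (measurableT_comp (fine_measurable measurableT)).
apply: (@measurableT_comp _ _ _ _ _ _
  ((fun q => (w q.1.1 q.1.2 q.2.1 q.2.2)%:E) \_ (unit_square `*` @torus R))
  _ (fun q : (R * R) * (R * R) => (q.1, (tfrac q.2.1, tfrac q.2.2)))).
  apply/(measurable_restrict _ _ _).1 => //.
    by apply: measurableX; [exact: measurable_unit_square|exact: measurable_torus].
  by rewrite setTI; apply/measurable_EFinP; case: fam.
apply: measurable_fun_pair => //.
have m1 : measurable_fun setT (fun q : (R * R) * (R * R) => q.2.1).
  by apply: (measurableT_comp measurable_fst); exact: measurable_snd.
have m2 : measurable_fun setT (fun q : (R * R) * (R * R) => q.2.2).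
  by apply: (measurableT_comp measurable_snd); exact: measurable_snd.
by apply: measurable_fun_pair; apply: (measurableT_comp (@measurable_tfrac R)).
Qed.

Lemma nonneg_measurable_ext st : nonneg_measurable (ext_weight st).
Proof.
split; last by move=> x y; exact: periodic_ext_ge0.
rewrite (_ : (fun z => _) = fun z => periodic_ext (st, z)).
  by apply: (measurableT_comp measurable_periodic_ext); exact: measurable_fun_pair.
by apply/funext => -[x y].
Qed.

Lemma ext_weight_torus st x y : unit_square st -> torus (x, y) ->
  (w st.1 st.2 x y)%:E = (ext_weight st x y)%:E.
Proof.
move=> stI [/=]; rewrite !in_itv/= => x01 y01.
by rewrite /ext_weight periodic_extE//= !tfrac_id.
Qed.

Lemma doubling_ext st : unit_square st -> doubling C (lift (ext_weight st)).
Proof.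
move=> stI; have [s t] := unit_squareP stI.
apply: (@eq_doubling (fun x y => (w st.1 st.2 x y)%:E)).
  by move=> x y; exact: ext_weight_torus.
by have [_] := fam.1 _ _ s t.
Qed.

Lemma avg_ext_fin st a1 l1 a2 l2 : unit_square st -> rect_param l1 l2 ->
  exists2 wQ : R, (0 <= wQ)%R & avg (rect a1 l1 a2 l2) (plane (ext_weight st)) = wQ%:E.
Proof.
move=> stI lp; have [s t] := unit_squareP stI.
have gu := nonneg_measurable_ext st.
set A := avg _ _; have A0 : 0 <= A by apply: avg_ge0 => z _; exact: plane_ge0.
exists (fine A); first exact: fine_ge0.
rewrite fineK// ge0_fin_numE//.
have [[_ /integrableP[_ it]] _] := fam.1 _ _ s t.
rewrite /A /avg lte_mul_pinfty//; last by rewrite ltry.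
  by apply: integral_ge0 => z _; exact: plane_ge0.
rewrite ge0_fin_numE; last by apply: integral_ge0 => z _; exact: plane_ge0.
apply: (le_lt_trans _ it).
apply: (le_trans (le_integral_subset gu (@measurable_rect R a1 l1 a2 l2)
  (@measurable_torus R) (@rect_sub_torus R a1 l1 a2 l2))).
rewrite le_eqVlt; apply/orP; left; apply/eqP; apply: eq_integral => -[x y] /[!inE] zT.
rewrite /plane /wf/= -ext_weight_torus//.
by rewrite ger0_norm// -lee_fin ext_weight_torus// lee_fin; exact: periodic_ext_ge0.
Qed.

Lemma avg_weightE z : wf (avg_weight w) z =
  \int[mu2]_(st in unit_square) (periodic_ext (st, (z.1 + st.1, z.2 + st.2)%R))%:E.
Proof.
by apply: eq_integral => st /[!inE] stI; rewrite periodic_extE.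
Qed.

Lemma measurable_shifted_ext : measurable_fun setT
  (fun q : (R * R) * (R * R) => periodic_ext (q.1, (q.2.1 + q.1.1, q.2.2 + q.1.2)%R)).
Proof.
have m21 : measurable_fun setT (fun q : (R * R) * (R * R) => q.2.1).
  by apply: (measurableT_comp measurable_fst); exact: measurable_snd.
have m22 : measurable_fun setT (fun q : (R * R) * (R * R) => q.2.2).
  by apply: (measurableT_comp measurable_snd); exact: measurable_snd.
have m11 : measurable_fun setT (fun q : (R * R) * (R * R) => q.1.1).
  by apply: (measurableT_comp measurable_fst); exact: measurable_fst.
have m12 : measurable_fun setT (fun q : (R * R) * (R * R) => q.1.2).
  by apply: (measurableT_comp measurable_snd); exact: measurable_fst.
apply: (measurableT_comp measurable_periodic_ext).
by apply: measurable_fun_pair => //; apply: measurable_fun_pair; exact: measurable_funD.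
Qed.

(** Written on the rotated rectangle with the unrotated weight, so that bounds on arbitrary
    rectangles apply to each [ext_weight st] directly. [fiber_avgE] gives the form on the fixed
    rectangle, which Tonelli's theorem needs. *)
Definition fiber_avg a1 l1 a2 l2 (g : R * R -> R) (st : R * R) : \bar R :=
  avg (shifted_rect a1 l1 a2 l2 st)
    (fun z => (g (rotN st z) * ext_weight st z.1 z.2)%:E).

Lemma fiber_avgE a1 l1 a2 l2 (g : R * R -> R) st : rect_param l1 l2 -> unit_square st ->
  measurable_fun setT g -> (forall z, (0 <= g z)%R) ->
  fiber_avg a1 l1 a2 l2 g st = avg (rect a1 l1 a2 l2)
    (fun z => (g z * periodic_ext (st, (z.1 + st.1, z.2 + st.2)%R))%:E).
Proof.
move=> lp stI mg g0; have [mu u0] := nonneg_measurable_ext st.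
rewrite /fiber_avg -avg_rotation//.
- apply: eq_avg => z /rect_sub_torus zT; rewrite rotNK// /ext_weight !periodic_extE//=.
  by congr (_ * w _ _ _ _)%:E; rewrite -[tfrac (tfrac _)]/(tfrac (tfrac _)) tfrac_id ?tfrac_itv.
- apply/measurable_EFinP; apply: measurable_funM => //.
  by apply: (measurableT_comp mg); exact: measurable_rotN.
- by move=> z; rewrite lee_fin mulr_ge0.
Qed.

Section Tonelli.
Variables (a1 l1 a2 l2 : R) (g : R * R -> R).
Hypotheses (lp : rect_param l1 l2) (mg : measurable_fun setT g).
Hypothesis g0 : forall z, (0 <= g z)%R.
Let Q := rect a1 l1 a2 l2.

Let F (q : (R * R) * (R * R)) : \bar R :=
  ((fun q => (g q.2 * periodic_ext (q.1, (q.2.1 + q.1.1, q.2.2 + q.1.2)%R))%:E)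
   \_ (unit_square `*` Q)) q.

Let mF : measurable_fun setT F.
Proof.
apply/(measurable_restrict _ _ _).1 => //.
  by apply: measurableX; [exact: measurable_unit_square|exact: measurable_rect].
apply: measurable_funTS; apply/measurable_EFinP; apply: measurable_funM.
  by apply: (measurableT_comp mg); exact: measurable_snd.
exact: measurable_shifted_ext.
Qed.

Let F0 q : 0 <= F q.
Proof.
rewrite /F patchE; case: ifP => // _.
by rewrite lee_fin mulr_ge0// periodic_ext_ge0.
Qed.

Let fiberE st : unit_square st ->
  fiber_avg a1 l1 a2 l2 g st = (\int[mu2]_z F (st, z)) * ((fine (mu2 Q))^-1)%:E.
Proof.
move=> stI; rewrite fiber_avgE// /avg integral_mkcond; congr (_ * _).
by apply: eq_integral => z _; rewrite /F !patchE in_setX/= (mem_set stI).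
Qed.

Lemma measurable_fiber_avg : measurable_fun unit_square (fiber_avg a1 l1 a2 l2 g).
Proof.
apply: (eq_measurable_fun
  (fun st => ((fine (mu2 Q))^-1)%:E * fubini_F mu2 F st)).
  by move=> st /[!inE] stI; rewrite fiberE// muleC.
apply: measurable_funTS; apply: measurable_funeM.
exact: (@measurable_fun_fubini_tonelli_F _ _ _ _ R sigma_finite_mu2 F mF F0).
Qed.

(** [g] does not depend on [(s, t)], so it enters the integral defining the averaged weight; the two
    integrations are then exchanged. *)
Lemma avg_avg_weight : avg Q (fun z => (g z)%:E * wf (avg_weight w) z) =
  \int[mu2]_(st in unit_square) fiber_avg a1 l1 a2 l2 g st.
Proof.
have mE := measurable_unit_square.
transitivity ((\int[mu2]_z \int[mu2]_st F (st, z)) * ((fine (mu2 Q))^-1)%:E).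
  rewrite /avg integral_mkcond; congr (_ * _); apply: eq_integral => z _.
  rewrite patchE; case: ifPn => zQ; last first.
    by apply/esym/integral0_eq => st _; rewrite /F patchE in_setX/= (negbTE zQ) andbF.
  rewrite avg_weightE -ge0_integralZl//; first last.
  - by rewrite lee_fin.
  - by move=> st _; rewrite lee_fin periodic_ext_ge0.
  - apply: measurable_funTS; apply/measurable_EFinP.
    apply: (measurableT_comp measurable_shifted_ext
      (g := fun st : R * R => (st, z))).
    exact: measurable_fun_pair.
  rewrite integral_mkcond; apply: eq_integral => st _.
  by rewrite /F !patchE in_setX/= zQ andbT; case: ifP => //; rewrite EFinM.
have FT : \int[mu2]_st \int[mu2]_z F (st, z) = \int[mu2]_z \int[mu2]_st F (st, z).
  exact: (@fubini_tonelli _ _ _ _ R sigma_finite_mu2 sigma_finite_mu2 F mF F0).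
rewrite -FT.
transitivity (\int[mu2]_st ((\int[mu2]_z F (st, z)) * ((fine (mu2 Q))^-1)%:E)).
  apply/esym; apply: ge0_integralZr.
  - exact: measurableT.
  - exact: (@measurable_fun_fubini_tonelli_F _ _ _ _ R sigma_finite_mu2 F mF F0).
  - by move=> st _; apply: integral_ge0 => z _; exact: F0.
  - by rewrite lee_fin invr_ge0 fine_ge0.
rewrite [RHS]integral_mkcond; apply: eq_integral => st _; rewrite patchE.
case: ifPn => [/[!inE] stI|stI]; first by rewrite fiberE.
suff -> : \int[mu2]_z F (st, z) = 0 by rewrite mul0e.
by apply: integral0_eq => z _; rewrite /F patchE in_setX/= (negbTE stI).
Qed.

Lemma fiber_avg_ge0 st : 0 <= fiber_avg a1 l1 a2 l2 g st.
Proof. by apply: avg_ge0 => z _; rewrite lee_fin mulr_ge0// periodic_ext_ge0. Qed.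

End Tonelli.

End Family.

End Transfer.

(** * Bounds for the averaged weight *)

Section Conclusion.
Variable R : realType.
Local Notation mu2 := (@mu2 R).
Local Open Scope ereal_scope.
Local Notation lift u := (fun x y => (u x y)%:E).

Lemma ae_of_avg_indic E (A : set (R * R)) : finite_pos E -> measurable A ->
  avg E (fun z => (\1_A z)%:E) = 0 -> {ae mu2, forall z, E z -> ~ A z}.
Proof.
move=> [mE [m m0 Em]] mA; rewrite /avg Em/= => h.
have AE0 : mu2 (A `&` E) = 0.
  have <- : \int[mu2]_(z in E) (\1_A z)%:E = mu2 (A `&` E) by exact: integral_indic.
  move: h; case: (\int[mu2]_(z in E) (\1_A z)%:E) => [x| |].
  - rewrite -EFinM => -[] /eqP; rewrite mulf_eq0 invr_eq0 (gt_eqF m0) orbF => /eqP ->//.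
  - by rewrite gt0_mulye ?lte_fin ?invr_gt0.
  - by rewrite gt0_mulNye ?lte_fin ?invr_gt0.
exists (A `&` E); split => //; first exact: measurableI.
by move=> z /= nz; split; apply: contrapT => nAE; apply: nz => Ez //.
Qed.

Lemma avg_bounded_mul_le E u (b : R) (g : R * R -> R) : finite_pos E -> nonneg_measurable u ->
  measurable_fun setT g -> (forall z, 0 <= g z <= b)%R -> (0 <= b)%R ->
  avg E (fun z => (g z * u z.1 z.2)%:E) <= b%:E * avg E (plane u).
Proof.
move=> pE gu mg gb b0; have [_ u0] := gu.
have g0 z : (0 <= g z)%R by case/andP: (gb z).
rewrite -avgZl//; [|exact: measurable_plane|by move=> z _; exact: plane_ge0].
apply: le_avg => //.
- exact: measurable_fun_plane_mul.
- by apply: measurable_funeM; exact: measurable_plane.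
- by move=> z _; rewrite lee_fin mulr_ge0.
- move=> z _; rewrite -EFinM lee_fin ler_wpM2r//; by case/andP: (gb z).
Qed.

Lemma mine_finE (y : \bar R) (n : nat) : 0 <= y ->
  (fine (mine y n%:R%:E))%:E = mine y n%:R%:E.
Proof.
move=> y0; have m0 : 0 <= mine y n%:R%:E by rewrite le_min y0 lee_fin ler0n.
rewrite fineK// ge0_fin_numE//; apply: (@le_lt_trans _ _ n%:R%:E).
  by rewrite ge_min lexx orbT.
by rewrite ltry.
Qed.

Lemma fine_mine_itv (y : \bar R) (n : nat) : 0 <= y ->
  (0 <= fine (mine y n%:R%:E) <= n%:R)%R.
Proof.
move=> y0; rewrite -!lee_fin mine_finE// le_min y0 lee_fin ler0n/=.
by rewrite ge_min lexx orbT.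
Qed.

(** The assumption says [f ^ (r - 1) * x <= 1]; multiply by [f]. For [x = +oo] it forces [f = 0]. *)
Lemma Ap_truncation_le (r f : R) (x : \bar R) : (1 < r)%R -> 0 <= x -> (0 <= f)%R ->
  f%:E <= poweR x^-1 (r - 1)^-1 -> (f `^ r)%:E * x <= f%:E.
Proof.
move=> r1 x0 f0.
have r10 : (0 < r - 1)%R by lra.
have r1i : (0 < (r - 1)^-1)%R by rewrite invr_gt0.
case: x x0 => [x| |]// x0.
- move: x0; rewrite lee_fin le_eqVlt => /predU1P[<- _|x0].
    by rewrite mule0 lee_fin.
  rewrite inver gt_eqF// poweR_EFin lee_fin -EFinM lee_fin => fx.
  rewrite -mulr_powRB1//; last by lra.
  rewrite -mulrA ler_piMr//.
  have : (f `^ (r - 1) <= (x^-1 `^ (r - 1)^-1) `^ (r - 1))%R.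
    by apply: ge0_ler_powR; rewrite ?nnegrE ?powR_ge0// ltW.
  rewrite powRVK//; last by rewrite invr_ge0 ltW.
  by rewrite -[X in (_ <= X)%R]mul1r ler_pdivlMr.
- rewrite invey poweR0r ?gt_eqF// lee_fin => fx.
  have -> : f = 0%R by apply/eqP; rewrite eq_le fx f0.
  by rewrite powR0 ?mul0e// gt_eqF//; lra.
Qed.

Section Family.
Variables (w : R -> R -> R -> R -> R) (C0 C V : R).
Hypotheses (C1 : (1 <= C)%R) (V1 : (1 <= V)%R) (CC : (C0 <= C)%R).
Hypotheses (fam : family_hyp C0 w) (wW : weight (avg_weight w)).
Local Notation W := (wf (avg_weight w)).
Local Notation u := (ext_weight w).

Let V0 : (0 < V)%R. Proof. exact: lt_le_trans ltr01 V1. Qed.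
Let Cp : (0 < C)%R. Proof. exact: lt_le_trans ltr01 C1. Qed.
Let gu st : nonneg_measurable (u st). Proof. exact: (nonneg_measurable_ext fam). Qed.
Let du st : unit_square st -> doubling C (lift (u st)).
Proof. by move=> stI; apply: (doubling_le (gu st) CC); exact: doubling_ext. Qed.

Lemma W_ge0 z : 0 <= W z.
Proof.
rewrite avg_weightE; apply: integral_ge0 => st _; rewrite lee_fin.
exact: (periodic_ext_ge0 fam).
Qed.

Lemma measurable_W : measurable_fun setT W.
Proof.
pose F (q : (R * R) * (R * R)) : \bar R :=
  ((fun q => (periodic_ext w (q.1, (q.2.1 + q.1.1, q.2.2 + q.1.2)%R))%:E)
   \_ (@unit_square R `*` setT)) q.
have mF : measurable_fun setT F.
  apply/(measurable_restrict _ _ _).1 => //.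
    by apply: measurableX => //; exact: measurable_unit_square.
  by apply: measurable_funTS; apply/measurable_EFinP; exact: (measurable_shifted_ext fam).
have F0 q : 0 <= F q.
  by rewrite /F patchE; case: ifP => // _; rewrite lee_fin (periodic_ext_ge0 fam).
have := @measurable_fun_fubini_tonelli_G _ _ _ _ R (sigma_finite_mu2 R) F mF F0.
congr measurable_fun; apply/funext => z; rewrite avg_weightE.
rewrite [RHS]integral_mkcond; apply: eq_integral => st _.
by rewrite /F !patchE in_setX/= in_setT andbT.
Qed.

Section OneRect.
Variables (a1 l1 a2 l2 : R).
Hypothesis lp : rect_param l1 l2.
Let Q := rect a1 l1 a2 l2.
Let Qst st := shifted_rect a1 l1 a2 l2 st.
Let pQ : finite_pos Q. Proof. exact: finite_pos_rect. Qed.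
Let mQ : measurable Q. Proof. exact: measurable_rect. Qed.
Let pQst st : finite_pos (Qst st). Proof. exact: finite_pos_rect. Qed.
Let fiber (g : R * R -> R) st := fiber_avg w a1 l1 a2 l2 g st.
Let mW D : measurable_fun D W. Proof. by apply: measurable_funTS; exact: measurable_W. Qed.

Lemma avg_W_fin : exists2 wQ : R, (0 <= wQ)%R & avg Q W = wQ%:E.
Proof.
have W0 := W_ge0.
have A0 : 0 <= avg Q W by exact: avg_ge0.
exists (fine (avg Q W)); first exact: fine_ge0.
rewrite fineK// ge0_fin_numE//.
have [_ /integrableP[_ it]] := wW.
rewrite /avg lte_mul_pinfty//; last by rewrite ltry.
  exact: integral_ge0.
rewrite ge0_fin_numE; last exact: integral_ge0.
apply: (le_lt_trans _ it).
apply: (@le_trans _ _ (\int[mu2]_(z in @torus R) W z)).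
  apply: ge0_subset_integral.
  - exact: mQ.
  - exact: measurable_torus.
  - exact: mW.
  - by [].
  - exact: rect_sub_torus.
rewrite le_eqVlt; apply/orP; left; apply/eqP; apply: eq_integral => z _.
by rewrite gee0_abs.
Qed.

Lemma fiber1 st : fiber (fun=> 1%R) st = avg (Qst st) (plane (u st)).
Proof. by apply: eq_avg => z _; rewrite mul1r. Qed.

Lemma transfer (a b : R) (g h : R * R -> R) : (0 <= a)%R -> (0 <= b)%R ->
  measurable_fun setT g -> measurable_fun setT h ->
  (forall z, 0 <= g z)%R -> (forall z, 0 <= h z)%R ->
  (forall st, unit_square st -> a%:E * fiber g st <= b%:E * fiber h st) ->
  a%:E * avg Q (fun z => (g z)%:E * W z) <= b%:E * avg Q (fun z => (h z)%:E * W z).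
Proof.
move=> a0 b0 mg mh g0 h0 gh.
rewrite (avg_avg_weight fam a1 a2 lp mg g0) (avg_avg_weight fam a1 a2 lp mh h0).
have mI := @measurable_unit_square R.
have f0 (f : R * R -> R) : (forall z, 0 <= f z)%R -> forall st, 0 <= fiber f st.
  by move=> f0 st; exact: (fiber_avg_ge0 fam).
have mf (f : R * R -> R) : measurable_fun setT f -> (forall z, 0 <= f z)%R ->
    measurable_fun (@unit_square R) (fiber f).
  by move=> *; exact: (measurable_fiber_avg fam).
have Zl (f : R * R -> R) (k : R) : (0 <= k)%R -> measurable_fun setT f -> (forall z, 0 <= f z)%R ->
    k%:E * \int[mu2]_(st in @unit_square R) fiber f st =
    \int[mu2]_(st in @unit_square R) (k%:E * fiber f st).
  move=> k0 m1 p1; apply/esym; apply: ge0_integralZl.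
  - exact: mI.
  - exact: mf.
  - by move=> st _; exact: f0.
  - by rewrite lee_fin.
rewrite (Zl g a a0 mg g0) (Zl h b b0 mh h0); apply: ge0_le_integral.
- exact: mI.
- by move=> st _; rewrite mule_ge0 ?lee_fin// f0.
- by apply: measurable_funeM; exact: mf.
- by apply: measurable_funeM; exact: mf.
- exact: gh.
Qed.

(** The inequality has to be supplied only on fibres of positive mass; on the others the left side
    is zero. *)
Lemma transfer_lower (a K : R) (h : R * R -> R) : (0 <= a)%R -> (0 <= K)%R ->
  measurable_fun setT h -> (forall z, 0 <= h z)%R ->
  (forall st wst, unit_square st -> (0 < wst)%R -> avg (Qst st) (plane (u st)) = wst%:E ->
    (a * wst)%:E <= K%:E * fiber h st) ->
  a%:E * avg Q W <= K%:E * avg Q (fun z => (h z)%:E * W z).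
Proof.
move=> a0 K0 mh h0 H.
rewrite (@eq_avg _ Q W (fun z => 1%:E * W z)); last by move=> z _; rewrite mul1e.
apply: (@transfer a K (fun=> 1%R) h) => // st stI; rewrite fiber1.
have [wst wst0 E] := @avg_ext_fin R w C0 fam st (a1 + st.1)%R l1 (a2 + st.2)%R l2 stI lp.
rewrite [avg _ _]E; move: wst0; rewrite le_eqVlt => /predU1P[<-|wst0].
  by rewrite mule0 mule_ge0 ?lee_fin//; exact: (fiber_avg_ge0 fam).
by rewrite -EFinM; exact: H.
Qed.

Lemma transfer_upper (b B : R) (h : R * R -> R) : (0 <= B)%R -> (0 <= b)%R ->
  measurable_fun setT h -> (forall z, 0 <= h z <= b)%R ->
  (forall st wst, unit_square st -> (0 < wst)%R -> avg (Qst st) (plane (u st)) = wst%:E ->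
    fiber h st <= (B * wst)%:E) ->
  avg Q (fun z => (h z)%:E * W z) <= B%:E * avg Q W.
Proof.
move=> B0 b0 mh hb H.
have h0 z : (0 <= h z)%R by case/andP: (hb z).
rewrite (@eq_avg _ Q W (fun z => 1%:E * W z)); last by move=> z _; rewrite mul1e.
rewrite -[leLHS]mul1e.
apply: (@transfer 1%R B h (fun=> 1%R)) => // st stI; rewrite fiber1 mul1e.
have [wst wst0 E] := @avg_ext_fin R w C0 fam st (a1 + st.1)%R l1 (a2 + st.2)%R l2 stI lp.
rewrite [X in _ <= _ * X]E; move: wst0; rewrite le_eqVlt => /predU1P[w0|wst0].
  (* On a fibre of mass zero, the bound [h <= b] makes the average of [h * u] vanish too. *)
  rewrite -w0 mule0 -(mule0 b%:E) -[X in _ <= _ * X]/(0%:E) w0 -E.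
  apply: (avg_bounded_mul_le (pQst st) (gu st) _ (fun z => hb _) b0).
  by apply: (measurableT_comp mh); exact: measurable_rotN.
by rewrite -EFinM; exact: H.
Qed.

Let measurable_fine_mine (F : R * R -> \bar R) (n : nat) : measurable_fun setT F ->
  measurable_fun setT (fun z => fine (mine (F z) n%:R%:E)).
Proof.
move=> mF; apply: (measurableT_comp (fine_measurable measurableT)).
by apply: measurable_mine => //; exact: measurable_cst.
Qed.

(** Test with [f], a truncation of [W ^ (-1 / (r - 1))] with average [F]. The linear inequality and
    [f ^ r * W <= f] give [(F / 2) ^ r * wQ <= K * F]; cancelling one finite factor [F] leaves
    [F ^ (r - 1) <= 2 ^ r * K / wQ]. *)
Lemma Ap_rect_W (r : R) : (1 < r)%R ->
  (forall st D, unit_square st -> dyad_rects D -> Ap_rect r%:E (lift (u st)) D <= V%:E) ->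
  Ap_rect r%:E (avg_weight w) Q <=
  (2 `^ r * (16 `^ (r - 1) * (4 * C ^+ 2 * V)))%:E.
Proof.
move=> r1 H; set K := (16 `^ (r - 1) * _)%R.
have r10 : (0 < r - 1)%R by lra.
have C20 : (0 < C ^+ 2)%R by exact: exprn_gt0.
have K0 : (0 < K)%R by rewrite /K !mulr_gt0// powR_gt0.
have p20 : (0 < 2 `^ r :> R)%R by rewrite powR_gt0.
have [wQ wQ0 WQ] := avg_W_fin; rewrite /Ap_rect gt_eqF// WQ.
move: wQ0; rewrite le_eqVlt => /predU1P[<-|wQ0].
  (* The convention [0 * +oo = 0] settles a rectangle on which [W] has no mass. *)
  by rewrite mul0e lee_fin ltW// mulr_gt0.
pose B := ((2 `^ r * K / wQ) `^ (r - 1)^-1)%R.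
have B0 : (0 <= B)%R by exact: powR_ge0.
have mS : measurable_fun setT (fun z => poweR (W z)^-1 (r - 1)^-1).
  apply: (measurableT_comp (measurable_poweR _)).
  by apply: measurable_inve_comp => // z _; exact: W_ge0.
suff SB : avg Q (fun z => poweR (W z)^-1 (r - 1)^-1) <= B%:E.
  have S0 : 0 <= avg Q (fun z => poweR (W z)^-1 (r - 1)^-1).
    by apply: avg_ge0 => z _; exact: poweR_ge0.
  move: SB S0; case: (avg Q _) => [S| |]//; rewrite !lee_fin => SB S0.
  rewrite mulrC -ler_pdivlMr//.
  rewrite -[leRHS](powRVK _ r10); last by rewrite divr_ge0 ?mulr_ge0// ltW.
  by apply: ge0_ler_powR; rewrite ?nnegrE ?powR_ge0// ltW.
apply: le_avg_truncation => //.
- exact: measurable_funTS.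
- by move=> z _; exact: poweR_ge0.
move=> n; pose f z := fine (mine (poweR (W z)^-1 (r - 1)^-1) n%:R%:E).
have fE z : (f z)%:E = mine (poweR (W z)^-1 (r - 1)^-1) n%:R%:E.
  by apply: mine_finE; exact: poweR_ge0.
rewrite (@eq_avg _ Q _ (fun z => (f z)%:E)); last by move=> z _; rewrite fE.
have fn z : (0 <= f z <= n%:R)%R by apply: fine_mine_itv; exact: poweR_ge0.
have f0 z : (0 <= f z)%R by case/andP: (fn z).
have mf : measurable_fun setT f by exact: measurable_fine_mine.
have mfE D : measurable_fun D (fun z => (f z)%:E).
  by apply: measurable_funTS; exact/measurable_EFinP.
have [F F0 fF] : exists2 F : R, (0 <= F)%R & avg Q (fun z => (f z)%:E) = F%:E.
  apply: (@avg_fin _ _ _ n%:R) => // z _; rewrite lee_fin; by case/andP: (fn z).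
have mfr : measurable_fun setT (fun z => f z `^ r)%R.
  exact: (measurableT_comp (measurable_powR _)).
have key : ((F / 2) `^ r)%:E * avg Q W <= K%:E * avg Q (fun z => (f z `^ r)%:E * W z).
  apply: transfer_lower => //; [exact: powR_ge0|exact: ltW|by move=> z; exact: powR_ge0|].
  move=> st wst stI wst0 Est.
  have sB := Apd_dual_bound C1 V1 (du stI) (gu st) lp Est wst0 r1 (fun D => H st D stI).
  have mfst : measurable_fun setT (fun z => f (rotN st z)).
    by apply: (measurableT_comp mf); exact: measurable_rotN.
  have fFst : avg (Qst st) (fun z => (f (rotN st z))%:E) = F%:E by rewrite avg_rotN.
  exact: (Ap_linear (pQst st) (gu st) r1 K0 wst0 sB mfst (fun z => f0 _) fFst F0).
have fW : avg Q (fun z => (f z `^ r)%:E * W z) <= F%:E.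
  rewrite -fF; apply: le_avg => //.
  - apply: emeasurable_funM => //.
    by apply: measurable_funTS; exact/measurable_EFinP.
  - by move=> z _; rewrite mule_ge0 ?W_ge0// lee_fin powR_ge0.
  - move=> z _; apply: Ap_truncation_le => //; first exact: W_ge0.
    by rewrite fE ge_min lexx.
rewrite fF lee_fin; move: F0; rewrite le_eqVlt => /predU1P[<-//|F0].
have {}key : ((F / 2) `^ r * wQ <= K * F)%R.
  rewrite -lee_fin [leLHS]EFinM -WQ; apply: (le_trans key).
  by rewrite [(K * F)%:E]EFinM lee_wpmul2l// lee_fin ltW.
rewrite -[leLHS](powRK (ltW F0) r10) /B; apply: ge0_ler_powR.
- by rewrite invr_ge0 ltW.
- by rewrite nnegrE powR_ge0.
- by rewrite nnegrE divr_ge0 ?mulr_ge0// ltW.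
rewrite ler_pdivlMr//.
move: key; rewrite powRM ?invr_ge0 ?(ltW F0)// powR_invl// -mulr_powRB1 ?(ltW F0)//; last by lra.
move=> key; rewrite -(ler_pM2l F0).
have := ler_wpM2l (ltW p20) key.
have -> : (2 `^ r * (F * F `^ (r - 1) / 2 `^ r * wQ) = F * (F `^ (r - 1) * wQ))%R.
  by field; rewrite gt_eqF.
by have -> : (2 `^ r * (K * F) = F * (2 `^ r * K))%R by ring.
Qed.

Let indic01 (A : set (R * R)) z : (0 <= (\1_A z : R) <= 1)%R.
Proof. by rewrite indicE; case: (_ \in _); rewrite /= ?lexx ?ler01. Qed.

Let avg_indic_fin (A : set (R * R)) : measurable A ->
  exists2 F : R, (0 <= F)%R & avg Q (fun z => (\1_A z)%:E) = F%:E.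
Proof.
move=> mA; apply: (@avg_fin _ _ _ 1%R pQ).
- by apply: measurable_funTS; apply/measurable_EFinP; exact: measurable_indic.
- by move=> z _; rewrite lee_fin.
- by move=> z _; rewrite lee_fin; case/andP: (indic01 A z).
Qed.

Let measurable_indic_W (A : set (R * R)) D : measurable A ->
  measurable_fun D (fun z => (\1_A z)%:E * W z).
Proof.
move=> mA; apply: emeasurable_funM; last exact: mW.
by apply: measurable_funTS; apply/measurable_EFinP; exact: measurable_indic.
Qed.

Let measurable_indic_cst (A : set (R * R)) D (c : \bar R) : measurable A ->
  measurable_fun D (fun z => c * (\1_A z)%:E).
Proof.
move=> mA; apply: measurable_funeM.
by apply: measurable_funTS; apply/measurable_EFinP; exact: measurable_indic.
Qed.

(** Let [A] be the set where [W < c] and [F] the average of its indicator. Then [F * wQ <= K * avg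
    (1_A * W) <= K * c * F = F * wQ / 2], which forces [F = 0]; the 2 in [c] is there for this. *)
Lemma A1_rect_W :
  (forall st D, unit_square st -> dyad_rects D -> Ap_rect 1%:E (lift (u st)) D <= V%:E) ->
  Ap_rect 1%:E (avg_weight w) Q <= (2 * (8 * C ^+ 2 * V))%:E.
Proof.
move=> H; set K := (8 * C ^+ 2 * V)%R.
have C20 : (0 < C ^+ 2)%R by exact: exprn_gt0.
have K0 : (0 < K)%R by rewrite /K !mulr_gt0.
have K20 : (0 < 2 * K)%R by lra.
have [wQ wQ0 WQ] := avg_W_fin; rewrite /Ap_rect eqxx WQ.
move: wQ0; rewrite le_eqVlt => /predU1P[<-|wQ0].
  by rewrite mul0e lee_fin ltW.
pose c := (wQ / (2 * K))%R; have c0 : (0 < c)%R by rewrite divr_gt0.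
pose A := [set z : R * R | W z < c%:E].
have mA : measurable A.
  by rewrite -[A]setTI; exact: (emeasurable_fun_infty_o measurableT measurable_W).
have [F F0 fF] := avg_indic_fin mA.
have key : F%:E * avg Q W <= K%:E * avg Q (fun z => (\1_A z)%:E * W z).
  apply: transfer_lower.
  - exact: F0.
  - exact: ltW.
  - exact: measurable_indic.
  - by move=> z; case/andP: (indic01 A z).
  move=> st wst stI wst0 Est.
  have uae := A1d_ae C1 V1 (du stI) (gu st) lp Est wst0 (fun D => H st D stI).
  have mfst : measurable_fun setT (fun z => \1_A (rotN st z) : R).
    by apply: (measurableT_comp (measurable_indic mA)); exact: measurable_rotN.
  have f0 z : (0 <= \1_A (rotN st z) :> R)%R by case/andP: (indic01 A (rotN st z)).
  have := A1_linear (pQst st) (gu st) K0 (ltW wst0) uae mfst f0.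
  have -> : avg (Qst st) (fun z => (\1_A (rotN st z))%:E) = F%:E.
    rewrite -fF; apply: (avg_rotN _ _ _ lp).
    - exact: measurable_indic.
    - by move=> z; case/andP: (indic01 A z).
  by rewrite -EFinM mulrC.
have fW : avg Q (fun z => (\1_A z)%:E * W z) <= c%:E * F%:E.
  rewrite -fF -(avgZl pQ); first last.
  - by rewrite lee_fin ltW.
  - by move=> z _; rewrite lee_fin; case/andP: (indic01 A z).
  - by apply: measurable_funTS; apply/measurable_EFinP; exact: measurable_indic.
  apply: le_avg.
  - exact: pQ.
  - exact: measurable_indic_W.
  - exact: measurable_indic_cst.
  - by move=> z _; rewrite mule_ge0 ?W_ge0// lee_fin; case/andP: (indic01 A z).
  - move=> z _; rewrite indicE muleC; have [zA|zA] := boolP (z \in A); last by rewrite !mule0.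
    by rewrite !mule1; move: zA; rewrite inE => /ltW.
have FE0 : F = 0%R.
  have : (F * wQ <= K * (c * F))%R.
    rewrite -lee_fin [leLHS]EFinM -WQ; apply: (le_trans key).
    by rewrite [(K * _)%:E]EFinM lee_wpmul2l// ?lee_fin ?(ltW K0)// [(c * F)%:E]EFinM.
  have -> : (K * (c * F) = F * wQ / 2)%R.
    by rewrite /c; field; rewrite gt_eqF.
  have : (0 <= F * wQ)%R by rewrite mulr_ge0// ltW.
  move=> h1 h2; have /eqP : (F * wQ = 0)%R by lra.
  by rewrite mulf_eq0 (gt_eqF wQ0) orbF => /eqP.
have inf_ge : c%:E <= essinf_on Q W.
  apply: ereal_sup_ubound; rewrite FE0 in fF.
  apply: ae_imply (ae_of_avg_indic pQ mA fF) => z h /h.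
  by rewrite /A/= leNgt => /negP.
have : (essinf_on Q W)^-1 <= (c^-1)%:E.
  move: inf_ge; case: (essinf_on Q W) => [e| |]//.
  - rewrite lee_fin => ce; have e0 := lt_le_trans c0 ce.
    by rewrite inver gt_eqF// lee_fin lef_pV2.
  - by move=> _; rewrite invey lee_fin invr_ge0; exact: ltW.
move=> h; apply: (le_trans (lee_wpmul2l _ h)); first by rewrite lee_fin ltW.
rewrite -EFinM lee_fin /c invf_div mulrC divfK// gt_eqF//.
Qed.

Lemma ae_W_eq0 : avg Q W = 0 -> {ae mu2, forall z, Q z -> W z <= 0}.
Proof.
move=> W0; have iW0 : \int[mu2]_(z in Q) `|W z| = 0.
  have -> : \int[mu2]_(z in Q) `|W z| = \int[mu2]_(z in Q) W z.
    by apply: eq_integral => z _; rewrite gee0_abs// W_ge0.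
  move: W0; have [_ [m m0 Em]] := pQ; rewrite /avg Em/=.
  case: (\int[mu2]_(z in Q) W z) => [x| |].
  - by rewrite -EFinM => -[] /eqP; rewrite mulf_eq0 invr_eq0 (gt_eqF m0) orbF => /eqP ->.
  - by rewrite gt0_mulye ?lte_fin ?invr_gt0.
  - by rewrite gt0_mulNye ?lte_fin ?invr_gt0.
have [/(_ iW0) h _] := ae_eq_integral_abs (sigma_finite_mu2 R) mQ (@mW Q).
by apply: ae_imply h => z hz /hz ->.
Qed.

(** Let [A] be the set where [W > c]. Then [c * F <= avg (1_A * W) <= K * F * wQ = c * F / 2] forces
    [F = 0]. *)
Lemma RHinf_rect_W :
  (forall st D, unit_square st -> dyad_rects D -> RHp_rect +oo (lift (u st)) D <= V%:E) ->
  RHp_rect +oo (avg_weight w) Q <= (2 * (2 * V * C ^+ 3))%:E.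
Proof.
move=> H; set K := (2 * V * C ^+ 3)%R.
have C30 : (0 < C ^+ 3)%R by exact: exprn_gt0.
have K0 : (0 < K)%R by rewrite /K !mulr_gt0.
have [wQ wQ0 WQ] := avg_W_fin; rewrite /RHp_rect WQ.
move: wQ0; rewrite le_eqVlt => /predU1P[w0|wQ0].
  (* The inverse of a zero average is [+oo], so the essential supremum itself has to be at most
     zero. *)
  have : esssup_on Q W <= 0.
    by apply: ereal_inf_lbound; apply: ae_W_eq0; rewrite WQ -w0.
  move=> h; apply: (@le_trans _ _ 0); last by rewrite lee_fin mulr_ge0// ltW.
  by rewrite -w0 inve0 mule_le0_ge0// leey.
pose c := (2 * K * wQ)%R; have c0 : (0 < c)%R by rewrite !mulr_gt0.
pose A := [set z : R * R | c%:E < W z].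
have mA : measurable A.
  by rewrite -[A]setTI; exact: (emeasurable_fun_o_infty measurableT measurable_W).
have [F F0 fF] := avg_indic_fin mA.
have key : avg Q (fun z => (\1_A z)%:E * W z) <= (K * F)%:E * avg Q W.
  apply: (@transfer_upper 1%R).
  - by rewrite mulr_ge0// ltW.
  - exact: ler01.
  - exact: measurable_indic.
  - by move=> z; exact: indic01.
  move=> st wst stI wst0 Est.
  have uae := RHinfd_ae C1 V1 (du stI) (gu st) lp Est wst0 (fun D => H st D stI).
  have mfst : measurable_fun setT (fun z => \1_A (rotN st z) : R).
    by apply: (measurableT_comp (measurable_indic mA)); exact: measurable_rotN.
  have f0 z : (0 <= \1_A (rotN st z) :> R)%R by case/andP: (indic01 A (rotN st z)).
  have Kw0 : (0 <= 2 * V * C ^+ 3 * wst)%R by rewrite ltW// !mulr_gt0.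
  have := RHinf_linear (pQst st) (gu st) Kw0 uae mfst f0.
  have -> : avg (Qst st) (fun z => (\1_A (rotN st z))%:E) = F%:E.
    rewrite -fF; apply: (avg_rotN _ _ _ lp).
    - exact: measurable_indic.
    - by move=> z; case/andP: (indic01 A z).
  by rewrite -EFinM mulrAC.
have fW : c%:E * F%:E <= avg Q (fun z => (\1_A z)%:E * W z).
  rewrite -fF -(avgZl pQ); first last.
  - by rewrite lee_fin ltW.
  - by move=> z _; rewrite lee_fin; case/andP: (indic01 A z).
  - by apply: measurable_funTS; apply/measurable_EFinP; exact: measurable_indic.
  apply: le_avg.
  - exact: pQ.
  - exact: measurable_indic_cst.
  - exact: measurable_indic_W.
  - by move=> z _; rewrite -EFinM lee_fin; apply: mulr_ge0; [exact: ltW|case/andP: (indic01 A z)].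
  - move=> z _; rewrite indicE [leRHS]muleC; have [zA|zA] := boolP (z \in A); last by rewrite !mule0.
    by rewrite !mule1; move: zA; rewrite inE => /ltW.
have FE0 : F = 0%R.
  have : (c * F <= K * F * wQ)%R.
    by rewrite -lee_fin [(c * F)%:E]EFinM; apply: (le_trans fW); rewrite [leRHS]EFinM -WQ.
  have -> : (c * F = 2 * (K * F * wQ))%R by rewrite /c; ring.
  have h1 : (0 <= K * F * wQ)%R by rewrite !mulr_ge0// ltW.
  move=> h2; have /eqP : (K * F * wQ = 0)%R by lra.
  by rewrite mulf_eq0 (gt_eqF wQ0) orbF mulf_eq0 (gt_eqF K0) => /eqP.
have sup_le : esssup_on Q W <= c%:E.
  apply: ereal_inf_lbound; rewrite FE0 in fF.
  apply: ae_imply (ae_of_avg_indic pQ mA fF) => z h /h.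
  by rewrite /A/= leNgt => /negP.
by rewrite inver gt_eqF// lee_pdivrMr.
Qed.

(** Let [m <= W] be the [p]-th root of a truncation of [W ^ p], and [G ^ p = avg (m ^ p)]. Then [G ^
    p <= avg (m ^ (p - 1) * W) <= 2 * K * G ^ (p - 1) * wQ], and cancelling [G ^ (p - 1)] leaves
    [G <= 2 * K * wQ]. *)
Lemma RHp_rect_W (p : R) : (1 < p)%R ->
  (forall st D, unit_square st -> dyad_rects D -> RHp_rect p%:E (lift (u st)) D <= V%:E) ->
  RHp_rect p%:E (avg_weight w) Q <= (2 * (16 * V * C ^+ 3))%:E.
Proof.
move=> p1 H; set K := (16 * V * C ^+ 3)%R.
have p0 : (0 < p)%R by lra.
have C30 : (0 < C ^+ 3)%R by exact: exprn_gt0.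
have K0 : (0 < K)%R by rewrite /K !mulr_gt0.
have [wQ wQ0 WQ] := avg_W_fin; rewrite /RHp_rect WQ.
have KwQ0 : (0 <= 2 * K * wQ)%R by rewrite !mulr_ge0// ltW.
have W0 := W_ge0.
suff SB : avg Q (fun z => poweR (W z) p) <= ((2 * K * wQ) `^ p)%:E.
  have S0 : 0 <= avg Q (fun z => poweR (W z) p).
    by apply: avg_ge0 => z _; exact: poweR_ge0.
  move: SB S0; case: (avg Q _) => [S| |]//; rewrite !lee_fin => SB S0.
  rewrite poweR_EFin.
  have : (S `^ p^-1 <= 2 * K * wQ)%R.
    rewrite -[leRHS](powRK _ p0)//; apply: ge0_ler_powR; rewrite ?nnegrE ?powR_ge0//.
    by rewrite invr_ge0 ltW.
  move: wQ0; rewrite le_eqVlt => /predU1P[<-|wQ0] h.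
    (* For [wQ = 0] the inverse average is [+oo], but the bound just obtained makes the other factor
       zero. *)
    have -> : (S `^ p^-1 = 0)%R by apply/eqP; rewrite eq_le powR_ge0 andbT; move: h; rewrite mulr0.
    by rewrite mul0e lee_fin mulr_ge0// ltW.
  by rewrite inver gt_eqF// -EFinM lee_fin ler_pdivrMr.
have mWp : measurable_fun setT (fun z => poweR (W z) p).
  by apply: (measurableT_comp (measurable_poweR _)); exact: measurable_W.
apply: (le_avg_truncation pQ).
- exact: measurable_funTS.
- by move=> z _; exact: poweR_ge0.
move=> n; pose f z := fine (mine (poweR (W z) p) n%:R%:E).
have fE z : (f z)%:E = mine (poweR (W z) p) n%:R%:E.
  by apply: mine_finE; exact: poweR_ge0.
rewrite (@eq_avg _ Q _ (fun z => (f z)%:E)); last by move=> z _; rewrite fE.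
have fn z : (0 <= f z <= n%:R)%R by apply: fine_mine_itv; exact: poweR_ge0.
have f0 z : (0 <= f z)%R by case/andP: (fn z).
have mf : measurable_fun setT f by exact: measurable_fine_mine.
pose m z := (f z `^ p^-1)%R.
have mp z : (m z `^ p = f z)%R by rewrite /m powRVK.
have m0 z : (0 <= m z)%R by exact: powR_ge0.
have mW_le z : (m z)%:E <= W z.
  have : (f z)%:E <= poweR (W z) p by rewrite fE ge_min lexx.
  case: (W z) (W0 z) => [x| |]//; rewrite ?leey//.
  rewrite poweR_EFin !lee_fin => x0 fx; rewrite -(powRK x0 p0).
  by apply: ge0_ler_powR; rewrite ?nnegrE ?powR_ge0// invr_ge0 ltW.
have mm : measurable_fun setT m by exact: (measurableT_comp (measurable_powR _)).
have [F F0 fF] : exists2 F : R, (0 <= F)%R & avg Q (fun z => (f z)%:E) = F%:E.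
  apply: (@avg_fin _ _ _ n%:R pQ).
  - by apply: measurable_funTS; exact/measurable_EFinP.
  - by move=> z _; rewrite lee_fin.
  - by move=> z _; rewrite lee_fin; case/andP: (fn z).
rewrite fF lee_fin; move: F0; rewrite le_eqVlt => /predU1P[<-|F0]; first exact: powR_ge0.
pose G := (F `^ p^-1)%R.
have G0 : (0 < G)%R by rewrite powR_gt0.
have Gp : (G `^ p = F)%R by rewrite /G powRVK// ltW.
have Gp1 : (0 < G `^ (p - 1))%R by rewrite powR_gt0.
have p10 : (0 <= p - 1)%R by lra.
have mh : measurable_fun setT (fun z => m z `^ (p - 1))%R.
  exact: (measurableT_comp (measurable_powR _)).
have key : avg Q (fun z => (m z `^ (p - 1))%:E * W z) <= (2 * K * G `^ (p - 1))%:E * avg Q W.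
  apply: (@transfer_upper (n%:R `^ p^-1 `^ (p - 1))%R).
  - by rewrite !mulr_ge0// ltW.
  - exact: powR_ge0.
  - exact: mh.
  - move=> z; rewrite powR_ge0/=; apply: ge0_ler_powR => //; rewrite ?nnegrE ?powR_ge0//.
    apply: ge0_ler_powR; rewrite ?nnegrE ?invr_ge0 ?(ltW p0)//.
    by case/andP: (fn z).
  move=> st wst stI wst0 Est.
  have uB := RHpd_power_bound C1 V1 (du stI) (gu st) lp Est wst0 p1 (fun D => H st D stI).
  have mst : measurable_fun setT (fun z => m (rotN st z)).
    by apply: (measurableT_comp mm); exact: measurable_rotN.
  have B0 : (0 < 16 * V * C ^+ 3 * wst)%R by rewrite !mulr_gt0.
  have mG : avg (Qst st) (fun z => (m (rotN st z) `^ p)%:E) = (G `^ p)%:E.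
    rewrite Gp -fF (@eq_avg _ _ _ (fun z => (f (rotN st z))%:E)); last by move=> z _; rewrite mp.
    exact: (avg_rotN _ _ _ lp mf f0).
  have := RHp_linear (pQst st) (gu st) p1 B0 G0 uB mst (fun z => m0 _) mG.
  have -> : (2 * (16 * V * C ^+ 3 * wst) * G `^ (p - 1) = 2 * K * G `^ (p - 1) * wst)%R.
    by rewrite /K; ring.
  by [].
have FW : F%:E <= avg Q (fun z => (m z `^ (p - 1))%:E * W z).
  rewrite -fF; apply: le_avg.
  - exact: pQ.
  - by apply: measurable_funTS; exact/measurable_EFinP.
  - apply: emeasurable_funM; last exact: mW.
    by apply: measurable_funTS; exact/measurable_EFinP.
  - by move=> z _; rewrite lee_fin.
  - move=> z _.
    have -> : f z = (m z `^ (p - 1) * m z)%R.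
      by rewrite -[LHS]mp -(mulr_powRB1 (m0 z) p0) mulrC.
    by rewrite EFinM; apply: lee_wpmul2l; [rewrite lee_fin powR_ge0|exact: mW_le].
have {}key : (F <= 2 * K * G `^ (p - 1) * wQ)%R.
  by rewrite -lee_fin (le_trans FW)// [leRHS]EFinM -WQ.
rewrite -Gp; apply: ge0_ler_powR; rewrite ?nnegrE ?(ltW p0) ?(ltW G0)//.
rewrite -(ler_pM2r Gp1) mulr_powRB1 ?(ltW G0)// Gp.
by have -> : (2 * K * wQ * G `^ (p - 1) = 2 * K * G `^ (p - 1) * wQ)%R by ring.
Qed.

(** Test with [h], a truncation of [log^+ (wQ / W)] with average [F]. Since [expR h * W <= wQ + W]
    has average at most [2 * wQ], the linear inequality gives [expR F <= 2 * expR M]; this is the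
    origin of [ln 2]. *)
Lemma Ainf_rect_W :
  (forall st D, unit_square st -> dyad_rects D -> Ap_rect +oo (lift (u st)) D <= V%:E) ->
  Ap_rect +oo (avg_weight w) Q <=
  (expR (16 * (ln (4 * C ^+ 2) + (ln V + 1)) + ln 2))%:E.
Proof.
move=> H; set M := (16 * _)%R.
have [wQ wQ0 WQ] := avg_W_fin.
have W0 := W_ge0.
move: wQ0; rewrite le_eqVlt => /predU1P[w0|wQ0].
  by rewrite /Ap_rect WQ -w0 mul0e lee_fin expR_ge0.
apply: (Ainf_of_log_plus pQ (@mW Q) (fun z _ => W0 z) wQ0 WQ).
have ml : measurable_fun setT (fun z => log_plus wQ (W z)).
  by apply: (measurableT_comp (@measurable_log_plus R wQ)); exact: measurable_W.
apply: (le_avg_truncation pQ).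
- exact: measurable_funTS.
- by move=> z _; exact: log_plus_ge0.
move=> n; pose h z := fine (mine (log_plus wQ (W z)) n%:R%:E).
have hE z : (h z)%:E = mine (log_plus wQ (W z)) n%:R%:E.
  by apply: mine_finE; exact: log_plus_ge0.
rewrite (@eq_avg _ Q _ (fun z => (h z)%:E)); last by move=> z _; rewrite hE.
have hn z : (0 <= h z <= n%:R)%R by apply: fine_mine_itv; exact: log_plus_ge0.
have h0 z : (0 <= h z)%R by case/andP: (hn z).
have mh : measurable_fun setT h by exact: measurable_fine_mine.
have [F F0 hF] : exists2 F : R, (0 <= F)%R & avg Q (fun z => (h z)%:E) = F%:E.
  apply: (@avg_fin _ _ _ n%:R pQ).
  - by apply: measurable_funTS; exact/measurable_EFinP.
  - by move=> z _; rewrite lee_fin.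
  - by move=> z _; rewrite lee_fin; case/andP: (hn z).
have mexp : measurable_fun setT (fun z => expR (h z)).
  exact: (measurableT_comp (@measurable_expR R)).
have key : (expR F)%:E * avg Q W <= (expR M)%:E * avg Q (fun z => (expR (h z))%:E * W z).
  apply: transfer_lower.
  - exact: expR_ge0.
  - exact: expR_ge0.
  - exact: mexp.
  - by move=> z; exact: expR_ge0.
  move=> st wst stI wst0 Est.
  have lB := Ainfd_log_plus C1 V1 (du stI) (gu st) lp Est wst0 (fun D => H st D stI).
  have mst : measurable_fun setT (fun z => h (rotN st z)).
    by apply: (measurableT_comp mh); exact: measurable_rotN.
  have hst : avg (Qst st) (fun z => (h (rotN st z))%:E) = F%:E.
    by rewrite -hF; exact: (avg_rotN _ _ _ lp mh h0).
  exact: (Ainf_linear (pQst st) (gu st) wst0 Est lB mst (fun z => h0 _) hst).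
have hW : avg Q (fun z => (expR (h z))%:E * W z) <= (wQ + wQ)%:E.
  rewrite EFinD -{2}WQ -(avg_cst wQ%:E pQ) -(avgD pQ); first last.
  - by move=> z _; exact: W0.
  - by move=> z _; rewrite lee_fin ltW.
  - exact: mW.
  - exact: measurable_cst.
  apply: le_avg.
  - exact: pQ.
  - apply: emeasurable_funM; last exact: mW.
    by apply: measurable_funTS; exact/measurable_EFinP.
  - by apply: emeasurable_funD; [exact: measurable_cst|exact: mW].
  - by move=> z _; rewrite mule_ge0// lee_fin expR_ge0.
  - move=> z _; apply: expR_log_plus_mul_le => //.
    by rewrite hE ge_min lexx.
rewrite hF lee_fin -ler_expR expRD lnK ?posrE//.
have : (expR F * wQ <= expR M * (wQ + wQ))%R.
  rewrite -lee_fin [leLHS]EFinM -WQ; apply: (le_trans key).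
  by rewrite [leRHS]EFinM lee_wpmul2l// lee_fin expR_ge0.
have -> : (expR M * (wQ + wQ) = expR M * 2 * wQ)%R by ring.
by rewrite ler_pM2r.
Qed.

End OneRect.
End Family.
End Conclusion.

(** * From the suprema over dyadic rectangles to the theorem *)

Section MainBounds.
Variable R : realType.
Local Open Scope ereal_scope.
Local Notation lift u := (fun x y => (u x y)%:E).
Variables (w : R -> R -> R -> R -> R) (V0 : R).

Lemma ext_weight_Ap_rect (p : \bar R) st D : unit_square st -> dyad_rects D ->
  (forall s t, s \in `[0%R, 1%R] -> t \in `[0%R, 1%R] ->
     Apd p (lift (w s t)) <= V0%:E) ->
  Ap_rect p (lift (ext_weight w st)) D <= (Num.max V0 1)%:E.
Proof.
move=> stI dD H; have [s t] := unit_squareP stI.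
rewrite -(@eq_Ap_rect R (lift (w st.1 st.2))); last 2 first.
- by move=> x y; exact: ext_weight_torus.
- exact: dyad_rects_sub.
apply: (@le_trans _ _ V0%:E); last by rewrite lee_fin le_max lexx.
by apply: le_trans (H _ _ s t); apply: ereal_sup_ubound; exists D.
Qed.

Lemma ext_weight_RHp_rect (p : \bar R) st D : unit_square st -> dyad_rects D ->
  (forall s t, s \in `[0%R, 1%R] -> t \in `[0%R, 1%R] ->
     RHpd p (lift (w s t)) <= V0%:E) ->
  RHp_rect p (lift (ext_weight w st)) D <= (Num.max V0 1)%:E.
Proof.
move=> stI dD H; have [s t] := unit_squareP stI.
rewrite -(@eq_RHp_rect R (lift (w st.1 st.2))); last 2 first.
- by move=> x y; exact: ext_weight_torus.
- exact: dyad_rects_sub.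
apply: (@le_trans _ _ V0%:E); last by rewrite lee_fin le_max lexx.
apply: le_trans (H _ _ s t); rewrite /RHpd le_max; apply/orP; left.
by apply: ereal_sup_ubound; exists D.
Qed.

End MainBounds.

Unset Implicit Arguments.

Theorem mainTheorem8 (R : realType) :
  (forall (p : \bar R) (V Cdbl : R), (1 <= p)%E ->
    exists K : R, forall w : R -> R -> R -> R -> R,
      family_hyp Cdbl w ->
      (forall s t, s \in `[0, 1] -> t \in `[0, 1] ->
         (Apd p (fun x y => (w s t x y)%:E) <= V%:E)%E) ->
      weight (avg_weight w) ->
      (Ap p (avg_weight w) <= K%:E)%E) /\
  (forall (p : \bar R) (V Cdbl : R), (1 < p)%E ->
    exists K : R, forall w : R -> R -> R -> R -> R,
      family_hyp Cdbl w ->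
      (forall s t, s \in `[0, 1] -> t \in `[0, 1] ->
         (RHpd p (fun x y => (w s t x y)%:E) <= V%:E)%E) ->
      weight (avg_weight w) ->
      (RHp p (avg_weight w) <= K%:E)%E).
Proof.
have m1 (x : R) : 1 <= Num.max x 1 by rewrite le_max lexx orbT.
have mx (x : R) : x <= Num.max x 1 by rewrite le_max lexx.
(* The estimates on a rectangle assume constants at least 1. Raising [V] and [C] to 1 if necessary
   keeps the hypotheses true, and the witnesses below involve only [p], [V] and [C]. *)
split=> p V C; pose V' := Num.max V 1; pose C' := Num.max C 1.
- case: p => [r| |]// r1.
  + have [{r1}->|rn1] := eqVneq r 1.
      exists (2 * (8 * C' ^+ 2 * V')) => w fam H wW.
      apply: ge_ereal_sup => _ [_ [a1 [l1 [a2 [l2 [lp ->]]]]] <-].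
      apply: (A1_rect_W (m1 C) (m1 V) (mx C) fam wW a1 a2 lp) => st D stI dD.
      exact: ext_weight_Ap_rect.
    have {rn1}r1 : 1 < r by rewrite lt_neqAle eq_sym rn1 -lee_fin.
    exists (2 `^ r * (16 `^ (r - 1) * (4 * C' ^+ 2 * V'))) => w fam H wW.
    apply: ge_ereal_sup => _ [_ [a1 [l1 [a2 [l2 [lp ->]]]]] <-].
    apply: (Ap_rect_W (m1 C) (m1 V) (mx C) fam wW a1 a2 lp r1) => st D stI dD.
    exact: ext_weight_Ap_rect.
  + exists (expR (16 * (ln (4 * C' ^+ 2) + (ln V' + 1)) + ln 2)) => w fam H wW.
    apply: ge_ereal_sup => _ [_ [a1 [l1 [a2 [l2 [lp ->]]]]] <-].
    apply: (Ainf_rect_W (m1 C) (m1 V) (mx C) fam wW a1 a2 lp) => st D stI dD.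
    exact: ext_weight_Ap_rect.
- case: p => [r| |]// r1.
  + exists (2 * (16 * V' * C' ^+ 3)) => w fam H wW.
    apply: ge_ereal_sup => _ [_ [a1 [l1 [a2 [l2 [lp ->]]]]] <-].
    apply: (RHp_rect_W (m1 C) (m1 V) (mx C) fam wW a1 a2 lp _) => // st D stI dD.
    exact: ext_weight_RHp_rect.
  + exists (2 * (2 * V' * C' ^+ 3)) => w fam H wW.
    apply: ge_ereal_sup => _ [_ [a1 [l1 [a2 [l2 [lp ->]]]]] <-].
    apply: (RHinf_rect_W (m1 C) (m1 V) (mx C) fam wW a1 a2 lp) => st D stI dD.
    exact: ext_weight_RHp_rect.
Qed.
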